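(* Let $(S,M,\mathbb T)$ be an ideal valency $1$-triangulation of a punctured polygon and let $(S,M,\mathbb T,\mathbb T^{\dagger})$ be an admissible cut of $(S,M,\mathbb T)$. Then the algebra $C_{\mathbb T^\dagger}$ induced by the admissible cut $(S,M,\mathbb T,\mathbb T^\dagger)$ is the algebra of an admissible cut of $B_{\mathbb T}$ (that is, the set of arrows of $Q_{\mathbb T}$ determined by $\mathbb T^\dagger$ contains exactly one arrow from each chordless oriented cycle of $Q_{\mathbb T}$). Moreover, $C_{\mathbb T^\dagger}$ is of global dimension at most two.
   Context: $k$ is an algebraically closed field. Surfaces. $S$ is a polygon with one or two punctures and $M$ is the set of its vertices and punctures. (The cases of interest are the $n$-gon with one puncture, type $\mathbb D_n$, and the $(n-2)$-gon with two punctures, type $\widetilde{\mathbb D}_n$.) Arcs are isotopy classes of curves without self-crossings, with endpoints in $M$, not isotopic to a point or a boundary segment; an ideal triangulation $\mathbb T$ is a maximal collection of pairwise non-crossing arcs, and cuts $S$ into triangles. A self-folded triangle has as sides a loop $\ell$ and, counted twice, a radius $r$ joining the base point of $\ell$ to the puncture enclosed by $\ell$. A triangle is internal if none of its sides is a boundary segment. The valency of a puncture is the number of arcs incident to it (loops counted twice). The triangulation is an ideal valency $1$-triangulation if every puncture has valency $1$; thus every puncture is enclosed in a self-folded triangle. A non-self-folded internal triangle is of type II, IV or V according to whether none, exactly one, or exactly two of its sides are loops of self-folded triangles. Quiver with potential. $Q_{\mathbb T}$ has the arcs of $\mathbb T$ as vertices. For each non-self-folded triangle $\triangle$ and each pair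 of sides $a,b$ of $\triangle$ which are arcs, with $b$ following $a$ in the clockwise order, there is an arrow from each element of $\{a\}\cup\{r_a\}$ to each element of $\{b\}\cup\{r_b\}$, where $r_a$ (present only if $a$ is the loop of a self-folded triangle) is the corresponding radius. For a valency $1$-triangulation this quiver has no further reduction, and the potential $W_{\mathbb T}$ is the sum, over all internal non-self-folded triangles $\triangle$, of all the 3-cycles of $Q_{\mathbb T}$ arising from $\triangle$: the cycle through the three sides of $\triangle$ and all cycles obtained from it by replacing one or two loops of self-folded triangles by the corresponding radii (one cycle for type II, two for type IV, four for type V). $B_{\mathbb T}$ is the Jacobian algebra of $(Q_{\mathbb T},W_{\mathbb T})$, the path algebra of $Q_{\mathbb T}$ modulo all cyclic partial derivatives of $W_{\mathbb T}$. Cuts. An admissible cut $\mathbb T^\dagger$ of $(S,M,\mathbb T)$ is a choice of exactly one angle in each internal non-self-folded triangle. If in $\triangle$ the chosen angle is the one between the sides $a$ and $b$, then the arrows of $Q_{\mathbb T}$ determined by it are all arrows arising from $\triangle$ between $\{a\}\cup\{r_a\}$ and $\{b\}\cup\{r_b\}$ (one arrow if neither $a$ nor $b$ is the loop of a self-folded triangle, two if exactly one is, four if both are). The algebra $C_{\mathbb T^\dagger}$ induced by the cut is the quotient of $B_{\mathbb T}$ by the ideal generated by all arrows determined by the chosen angles. A chordless cycle in a quiver is the full subquiver generated by a set of points $\{x_1,\dots,x_t\}$ which is topologically a cycle, i.e. the edges between the $x_i$ are precisely those of the form $x_i$ — $x_{i+1}$ (with $x_{t+1}=x_1$). An admissible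 cut of a quiver is a set of arrows consisting of exactly one arrow from each chordless oriented cycle; the algebra of the cut is the quotient of the Jacobian algebra by the arrows of the cut. *)

(* Defs.v *)
From HB Require Import structures.
From mathcomp Require Import all_boot all_algebra boolp.
From mathcomp Require Import finmap monalg.

Set Implicit Arguments.
Unset Strict Implicit.
Unset Printing Implicit Defensive.

Import GRing.Theory.
Local Open Scope ring_scope.
Local Open Scope quotient_scope.

Inductive two_sided_ideal (R : pzRingType) (G : R -> Prop) : R -> Prop :=
| ideal_gen x of G x : two_sided_ideal G x
| ideal_zero : two_sided_ideal G 0
| ideal_sub x y of two_sided_ideal G x & two_sided_ideal G y :
    two_sided_ideal G (x - y)
| ideal_mull a x of two_sided_ideal G x : two_sided_ideal G (a * x)
| ideal_mulr x a of two_sided_ideal G x : two_sided_ideal G (x * a).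

Section QuotientRing.
Variables (R : pzRingType) (G : R -> Prop).

Definition ideal_pred : {pred R} := fun x => `[< two_sided_ideal G x >].

Lemma ideal_predP x : reflect (two_sided_ideal G x) (x \in ideal_pred).
Proof. exact: asboolP. Qed.

Lemma ideal_pred_zmod : zmod_closed ideal_pred.
Proof.
split=> [|x y /ideal_predP Ix /ideal_predP Iy]; apply/ideal_predP.
  exact: ideal_zero.
exact: ideal_sub.
Qed.
HB.instance Definition _ := GRing.isZmodClosed.Build R ideal_pred ideal_pred_zmod.

(* A pzRingType, since the two-sided ideal generated by G is allowed to be R. *)
Definition quot_ring := Quotient.quot ideal_pred.
HB.instance Definition _ := GRing.Zmodule.on quot_ring.
HB.instance Definition _ := EqQuotient.on quot_ring.

Definition quot_proj (x : R) : quot_ring := \pi_quot_ring x.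

Lemma quot_projK : cancel (repr : quot_ring -> R) quot_proj.
Proof. exact: reprK. Qed.

Lemma quot_proj_eq x y : quot_proj x = quot_proj y <-> two_sided_ideal G (x - y).
Proof.
split=> [/eqP|Ixy]; last apply/eqP; rewrite -Quotient.idealrBE.
  by move/ideal_predP.
exact/ideal_predP.
Qed.

Lemma quot_projB : {morph quot_proj : x y / x - y}.
Proof. by move=> x y; rewrite /quot_proj Quotient.pi_add Quotient.pi_opp. Qed.

Lemma quot_projD : {morph quot_proj : x y / x + y}.
Proof. by move=> x y; rewrite /quot_proj Quotient.pi_add. Qed.

Definition quot_one : quot_ring := quot_proj 1.
Definition quot_mul (x y : quot_ring) : quot_ring := quot_proj (repr x * repr y).

Lemma quot_proj_mul : {morph quot_proj : x y / x * y >-> quot_mul x y}.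
Proof.
move=> x y; apply/quot_proj_eq.
set x' := repr _; set y' := repr _.
have Ix : two_sided_ideal G (x - x') by apply/quot_proj_eq; rewrite quot_projK.
have Iy : two_sided_ideal G (y' - y) by apply/quot_proj_eq; rewrite quot_projK.
have -> : x * y - x' * y' = (x - x') * y - x' * (y' - y).
  by rewrite mulrBl mulrBr opprB addrA subrK.
by apply: ideal_sub; [apply: ideal_mulr | apply: ideal_mull].
Qed.

Lemma quot_mulA : associative quot_mul.
Proof.
move=> x y z; rewrite -[x]quot_projK -[y]quot_projK -[z]quot_projK.
by rewrite -!quot_proj_mul mulrA.
Qed.

Lemma quot_mul1 : left_id quot_one quot_mul.
Proof. by move=> x; rewrite -[x]quot_projK -quot_proj_mul mul1r. Qed.

Lemma quot_1mul : right_id quot_one quot_mul.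
Proof. by move=> x; rewrite -[x]quot_projK -quot_proj_mul mulr1. Qed.

Lemma quot_mulDl : left_distributive quot_mul +%R.
Proof.
move=> x y z; rewrite -[x]quot_projK -[y]quot_projK -[z]quot_projK.
by rewrite -quot_projD -!quot_proj_mul -quot_projD mulrDl.
Qed.

Lemma quot_mulDr : right_distributive quot_mul +%R.
Proof.
move=> x y z; rewrite -[x]quot_projK -[y]quot_projK -[z]quot_projK.
by rewrite -quot_projD -!quot_proj_mul -quot_projD mulrDr.
Qed.

HB.instance Definition _ := GRing.Zmodule_isPzRing.Build quot_ring
  quot_mulA quot_mul1 quot_1mul quot_mulDl quot_mulDr.

Lemma quot_proj_monoid : monoid_morphism quot_proj.
Proof. by split=> // x y; rewrite quot_proj_mul. Qed.
HB.instance Definition _ := GRing.isZmodMorphism.Build R quot_ring quot_proj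
  quot_projB.
HB.instance Definition _ := GRing.isMonoidMorphism.Build R quot_ring quot_proj
  quot_proj_monoid.

End QuotientRing.

Section GlobalDimension.
Variable A : pzRingType.

Definition projective_module (P : lmodType A) : Prop :=
  forall (M N : lmodType A) (g : {linear M -> N}) (h : {linear P -> N}),
    (forall y, exists x, g x = y) ->
    exists h' : {linear P -> M}, forall x, g (h' x) = h x.

(* There is a projective resolution
     0 -> P n -> ... -> P 1 -> P 0 -> M -> 0. *)
Definition proj_dim_le (M : lmodType A) (n : nat) : Prop :=
  exists (P : nat -> lmodType A) (d : forall i, {linear P i.+1 -> P i})
         (aug : {linear P 0%N -> M}),
    [/\ forall i, projective_module (P i),
        forall m, exists x, aug x = m,
        forall x, aug x = 0 <-> exists y, d 0%N y = x,
        forall i x, d i x = 0 <-> exists y, d i.+1 y = x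
      & forall i, (n < i)%N -> forall x : P i, x = 0].

(* Left modules are used; on the two-sided noetherian (here even
   finite-dimensional) algebras the left and right dimensions coincide. *)
Definition global_dim_le (n : nat) : Prop :=
  forall M : lmodType A, proj_dim_le M n.

End GlobalDimension.

Record quiver := Quiver {
  vertex : finType;
  arrow : finType;
  src : arrow -> vertex;
  tgt : arrow -> vertex
}.
Arguments src {q}.
Arguments tgt {q}.

Fixpoint composable (Q : quiver) (v : vertex Q) (s : seq (arrow Q)) : bool :=
  if s is a :: s' then (src a == v) && composable (tgt a) s' else true.

(* A path is its source together with the arrows, in the order in which they
   are travelled; the empty sequence gives the trivial path at the source. *)
Definition qpath (Q : quiver) : Type :=
  {p : vertex Q * seq (arrow Q) | composable p.1 p.2}.
HB.instance Definition _ (Q : quiver) := Choice.on (qpath Q).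

Section Paths.
Variable Q : quiver.
Implicit Types (v : vertex Q) (s : seq (arrow Q)) (p q r : qpath Q).

Definition source p : vertex Q := (val p).1.
Definition arrows p : seq (arrow Q) := (val p).2.
Definition target p : vertex Q := last (source p) [seq tgt a | a <- arrows p].

Lemma composable_cat v s1 s2 :
  composable v (s1 ++ s2) =
  composable v s1 && composable (last v [seq tgt a | a <- s1]) s2.
Proof. by elim: s1 v => //= a s1 IH v; rewrite IH andbA. Qed.

End Paths.

Section PathAlgebra.
Variables (k : fieldType) (Q : quiver).
Implicit Types (v : vertex Q) (s : seq (arrow Q)) (p q r : qpath Q).

Definition path_algebra : Type := {malg k[qpath Q]}.
HB.instance Definition _ := GRing.Lmodule.on path_algebra.
Implicit Types f g h : path_algebra.

Section LinearExtension.
Variable V : lmodType k.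
Implicit Types F G : qpath Q -> V.

(* The linear extension of a function on the basis of paths. *)
Definition linext F f : V := \sum_(p <- msupp f) f@_p *: F p.

Lemma linextEw F f (d : {fset qpath Q}) : (msupp f `<=` d)%fset ->
  linext F f = \sum_(p <- d) f@_p *: F p.
Proof.
move=> fd; rewrite /linext (big_fset_incl _ fd) //= => p _ /mcoeff_outdom ->.
by rewrite scale0r.
Qed.

Lemma linextD F : {morph linext F : f g / f + g}.
Proof.
move=> f g; have := msuppD_le f g.
rewrite (linextEw F (fsubsetUl (msupp f) (msupp g))).
rewrite (linextEw F (fsubsetUr (msupp f) (msupp g))) => /linextEw ->.
by rewrite -big_split; apply: eq_bigr => p _; rewrite mcoeffD scalerDl.
Qed.

Lemma linextZ F c : {morph linext F : f / c *: f}.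
Proof.
move=> f; rewrite (linextEw F (msuppZ_le c f)) /linext scaler_sumr.
by apply: eq_bigr => p _; rewrite mcoeffZ scalerA.
Qed.

Lemma linext0 F : linext F 0 = 0.
Proof. by rewrite -[0 in LHS](scale0r (0 : path_algebra)) linextZ scale0r. Qed.

Lemma linext_sum F (I : Type) (t : seq I) (P : pred I) (E : I -> path_algebra) :
  linext F (\sum_(i <- t | P i) E i) = \sum_(i <- t | P i) linext F (E i).
Proof. exact: (big_morph _ (linextD F) (linext0 F)). Qed.

Lemma linextU F p : linext F (<< p >> : path_algebra) = F p.
Proof.
by rewrite /linext msuppU oner_eq0 big_seq_fset1 mcoeffUU scale1r.
Qed.

Lemma eq_linext F G f : F =1 G -> linext F f = linext G f.
Proof. by move=> FG; apply: eq_bigr => p _; rewrite FG. Qed.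

Lemma linext_addF F G f :
  linext (fun p => F p + G p) f = linext F f + linext G f.
Proof. by rewrite /linext -big_split; apply: eq_bigr => p _; rewrite scalerDr. Qed.

End LinearExtension.

Lemma linext_comp (V : lmodType k) F (H : qpath Q -> V) f :
  linext H (linext F f) = linext (fun p => linext H (F p)) f.
Proof. by rewrite linext_sum; apply: eq_bigr => p _; rewrite linextZ. Qed.

Lemma linext_id f : linext (fun p => << p >> : path_algebra) f = f.
Proof.
rewrite [RHS]monalgE; apply: eq_bigr => p _; apply/malgP => q.
by rewrite mcoeffZ [in LHS]mcoeffU [in RHS]mcoeffU mulrnAr mulr1.
Qed.

(* The element of the path algebra given by the path with source v and arrows
   s; it is 0 if these do not form a path. *)
Definition pathE v s : path_algebra :=
  if insub (v, s) is Some p then << p >> else 0.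

(* Product of two paths: first p, then q. *)
Definition path_mul p q : path_algebra :=
  if target p == source q then pathE (source p) (arrows p ++ arrows q) else 0.

Definition pa_mul f g : path_algebra :=
  linext (fun p => linext (path_mul p) g) f.
Definition pa_one : path_algebra := \sum_v pathE v [::].

Lemma pathE_val p : pathE (source p) (arrows p) = << p >>.
Proof. by rewrite /pathE /source /arrows -surjective_pairing valK. Qed.

Lemma pathEP v s : composable v s ->
  exists2 p, pathE v s = << p >> & source p = v /\ arrows p = s.
Proof.
move=> vs; exists (exist _ (v, s) vs) => //.
by rewrite -pathE_val.
Qed.

Lemma pa_mulA : associative pa_mul.
Proof.
move=> f g h; pose E r := linext (path_mul r) h.
have -> : pa_mul (pa_mul f g) h =
    linext (fun p => linext (fun q => linext E (path_mul p q)) g) f.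
  rewrite -[LHS]/(linext E (linext (fun p => linext (path_mul p) g) f)).
  by rewrite [LHS]linext_comp; apply: eq_linext => p; exact: linext_comp.
apply: eq_linext => p.
rewrite -[LHS]/(linext (path_mul p) (linext (fun q => linext (path_mul q) h) g)).
rewrite [LHS]linext_comp; apply: eq_linext => q; rewrite [LHS]linext_comp.
rewrite [in RHS]/path_mul.
have [pq|npq] := eqVneq (target p) (source q); last first.
  rewrite [RHS]linext0 [LHS]/linext big1 // => r _.
  rewrite [path_mul q r]/path_mul; case: ifP => _; last by rewrite linext0 scaler0.
  rewrite /pathE; case: insubP => [u _ vu|_]; last by rewrite linext0 scaler0.
  by rewrite linextU /path_mul /source vu /= (negbTE npq) scaler0.
have cpq : composable (source p) (arrows p ++ arrows q).
  by rewrite composable_cat (valP p) -/(target p) pq (valP q).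
have [pq' -> [sE aE]] := pathEP cpq; rewrite [RHS]linextU /E.
apply: eq_linext => r; rewrite [path_mul q r]/path_mul [in RHS]/path_mul.
have -> : target pq' = target q.
  by rewrite /target sE aE map_cat last_cat -/(target p) pq.
have [qr|nqr] := eqVneq (target q) (source r); last exact: linext0.
have cqr : composable (source q) (arrows q ++ arrows r).
  by rewrite composable_cat (valP q) -/(target q) qr (valP r).
have [qr' -> [sE' aE']] := pathEP cqr; rewrite [LHS]linextU /path_mul.
by rewrite sE' pq eqxx sE aE aE' catA.
Qed.

Lemma pa_mul1 : left_id pa_one pa_mul.
Proof.
move=> f; rewrite /pa_mul linext_sum -[RHS]linext_id.
transitivity (\sum_v linext (fun q => if v == source q then << q >> else 0 : path_algebra) f).
  apply: eq_bigr => v _; have [p -> [sE aE]] := @pathEP v [::] isT.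
  rewrite linextU; apply: eq_linext => q; rewrite /path_mul /target sE aE /=.
  by case: eqP => // ->; rewrite pathE_val.
rewrite /linext exchange_big; apply: eq_bigr => q _.
rewrite -scaler_sumr; congr (_ *: _).
by rewrite -big_mkcond big_pred1_eq.
Qed.

Lemma pa_1mul : right_id pa_one pa_mul.
Proof.
move=> f; rewrite /pa_mul -[RHS]linext_id; apply: eq_linext => p.
rewrite linext_sum (bigD1 (target p)) //= big1 ?addr0 => [|v vp].
  have [q -> [sE aE]] := @pathEP (target p) [::] isT.
  by rewrite linextU /path_mul sE aE eqxx cats0 pathE_val.
have [q -> [sE aE]] := @pathEP v [::] isT.
by rewrite linextU /path_mul sE eq_sym (negbTE vp).
Qed.

Lemma pa_mulDl : left_distributive pa_mul +%R.
Proof. by move=> f g h; rewrite /pa_mul linextD. Qed.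

Lemma pa_mulDr : right_distributive pa_mul +%R.
Proof.
move=> f g h; rewrite /pa_mul -linext_addF; apply: eq_linext => p.
by rewrite linextD.
Qed.

HB.instance Definition _ := GRing.Zmodule_isPzRing.Build path_algebra
  pa_mulA pa_mul1 pa_1mul pa_mulDl pa_mulDr.

Definition arrowE (a : arrow Q) : path_algebra := pathE (src a) [:: a].

(* Cyclic derivative: the cycle a_1 ... a_d is sent to the sum, over the i with
   a_i = a, of a_(i+1) ... a_d a_1 ... a_(i-1). *)
Definition cyclic_derivative (a : arrow Q) : path_algebra -> path_algebra :=
  linext (fun p => if target p == source p then
    \sum_(i < size (arrows p) | nth a (arrows p) i == a)
      pathE (tgt a) (drop i.+1 (arrows p) ++ take i (arrows p))
    else 0).

Definition jacobian_algebra (W : path_algebra) : pzRingType :=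
  quot_ring (fun x : path_algebra => exists a, x = cyclic_derivative a W).

Definition cut_algebra (W : path_algebra) (Delta : {set arrow Q}) : pzRingType :=
  quot_ring (fun x : jacobian_algebra W =>
    exists2 a, a \in Delta & x = quot_proj _ (arrowE a)).

End PathAlgebra.

(* The points c = x_1, ..., x_t generate a full subquiver whose arrows are
   precisely one arrow x_i -> x_(i+1) for each i (cyclically). *)
Definition chordless_oriented_cycle (Q : quiver) (c : seq (vertex Q)) : Prop :=
  [/\ c != [::], uniq c &
      {in c &, forall x y,
        #|[set a : arrow Q | (src a == x) && (tgt a == y)]|
          = (y == next c x) :> nat}].

Definition arrows_on (Q : quiver) (c : seq (vertex Q)) : {set arrow Q} :=
  [set a | (src a \in c) && (tgt a \in c)].

Definition admissible_quiver_cut (Q : quiver) (Delta : {set arrow Q}) : Prop :=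
  (forall c, chordless_oriented_cycle c -> #|Delta :&: arrows_on c| = 1%N) /\
  (forall a, a \in Delta ->
     exists2 c, chordless_oriented_cycle c & a \in arrows_on c).

(* A triangulated oriented surface with boundary, presented by gluing triangles
   along sides. A dart is a side of a triangle, travelled clockwise around that
   triangle: cw sends it to the next side of the same triangle in the clockwise
   order, and opp to the side it is glued to (with the direction reversed), a
   side which is not glued, i.e. lies on the boundary, being fixed by opp.
   Sides of the same triangle may be glued to one another, which gives
   self-folded triangles. *)
Record triangulated_surface := TriangulatedSurface {
  dart : finType;
  cw : dart -> dart;
  opp : dart -> dart;
  cw3 : forall d, cw (cw (cw d)) = d;
  cw_neq : forall d, cw d != d;
  oppK : involutive opp
}.
Arguments cw {t}.
Arguments opp {t}.

Section Triangulation.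
Variable T : triangulated_surface.
Implicit Types d : dart T.

Definition interior d := opp d != d.

Definition edge d : {set dart T} := [set d; opp d].
Definition triangle d : {set dart T} := [set d; cw d; cw (cw d)].

(* For d interior, d and cw (opp d) start at the same point of M, and these
   identifications generate the equality of starting points of darts. *)
Definition same_start d d' :=
  (interior d && (d' == cw (opp d))) || (interior d' && (d == cw (opp d'))).

(* A point of M, as the set of the darts which start at it. *)
Definition start d : {set dart T} := [set d' | connect same_start d d'].

Definition edges := [set edge d | d : dart T].
Definition triangles := [set triangle d | d : dart T].
Definition points := [set start d | d : dart T].
Definition arcs := [set edge d | d : dart T & interior d].

(* A point on the boundary is the starting point of a boundary dart. *)
Definition punctures := [set v in points | [forall d in v, interior d]].

(* Connected and of Euler characteristic 1, i.e. 2 - 2g - b = 1, so g = 0 and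
   b = 1: a disc. In such a gluing no two edges are isotopic and none is
   contractible (an Euler characteristic count excludes triangulated monogons
   and digons without punctures), so that the glued sides are the arcs of an
   ideal triangulation, and every ideal triangulation arises in this way. *)
Definition punctured_polygon : Prop :=
  [/\ forall d d', connect [rel x y | (y == cw x) || (y == opp x)] d d',
      (#|points| + #|triangles| = #|edges| + 1)%N
    & (1 <= #|punctures| <= 2)%N].

(* The two darts of an arc start at its two ends. *)
Definition valency (v : {set dart T}) : nat := \sum_(A in arcs) #|A :&: v|.

Definition valency1 : Prop := forall v, v \in punctures -> valency v = 1%N.

(* Two sides of the triangle of d are glued together. *)
Definition self_folded d :=
  [|| opp d == cw d, opp (cw d) == cw (cw d) | opp (cw (cw d)) == d].

Definition internal d := [&& interior d, interior (cw d) & interior (cw (cw d))].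

(* For d in a non-self-folded triangle: the triangle on the other side of d is
   self-folded, with loop d. Its radius is then edge (cw (opp d)). *)
Definition is_loop d := interior d && (opp (cw (opp d)) == cw (cw (opp d))).

(* The elements of {d} U {r_d}: the side d itself for false, and, if d is the
   loop of a self-folded triangle, its radius for true. *)
Definition side_ok d (rad : bool) := interior d && (rad ==> is_loop d).
Definition side_dart d (rad : bool) := if rad then cw (opp d) else d.

Lemma side_arc d rad : side_ok d rad -> edge (side_dart d rad) \in arcs.
Proof.
case/andP=> di; case: rad => [/=/andP[_ /eqP dl]|_]; last first.
  by apply/imsetP; exists d; rewrite ?inE.
apply/imsetP; exists (cw (opp d)) => //.
by rewrite inE /interior dl cw_neq.
Qed.

Definition qvertex : Type := {A : {set dart T} | A \in arcs}.
HB.instance Definition _ := Finite.on qvertex.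

(* (d, r, r'): an arrow arising from the angle between the sides d and cw d. *)
Definition is_arrow (x : dart T * bool * bool) : bool :=
  let: (d, r, r') := x in
  [&& ~~ self_folded d, side_ok d r & side_ok (cw d) r'].

Definition qarrow : Type := {x : dart T * bool * bool | is_arrow x}.
HB.instance Definition _ := Finite.on qarrow.

Definition angle (a : qarrow) : dart T := (val a).1.1.

Lemma src_proof (a : qarrow) : edge (side_dart (angle a) (val a).1.2) \in arcs.
Proof. apply: side_arc; case: a => -[[d r] r'] ok; by case/and3P: (ok). Qed.

Lemma tgt_proof (a : qarrow) : edge (side_dart (cw (angle a)) (val a).2) \in arcs.
Proof. apply: side_arc; case: a => -[[d r] r'] ok; by case/and3P: (ok). Qed.

Definition triangulation_quiver : quiver :=
  @Quiver qvertex qarrow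
    (fun a => exist (fun A => A \in arcs) _ (src_proof a))
    (fun a => exist (fun A => A \in arcs) _ (tgt_proof a)).

(* The sum of the 3-cycles a b c arising from the triangles. The condition on
   froot selects one dart in each triangle, so that each cycle is taken once up
   to rotation; the arrows a b c form a cycle only if the triangle is internal,
   since all its sides must then be arcs. *)
Definition potential (k : fieldType) : path_algebra k triangulation_quiver :=
  \sum_(a : arrow triangulation_quiver) \sum_(b : arrow triangulation_quiver)
  \sum_(c : arrow triangulation_quiver |
       [&& froot cw (angle a) == angle a,
           angle b == cw (angle a), angle c == cw (angle b),
           tgt a == src b, tgt b == src c & tgt c == src a])
    pathE k (src a) [:: a; b; c].

(* The angle between the sides d and cw d is represented by d. *)
Definition admissible_cut (cut : {set dart T}) : Prop :=
  (forall d, d \in cut -> internal d && ~~ self_folded d) /\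
  (forall d, internal d -> ~~ self_folded d -> #|cut :&: triangle d| = 1%N).

Definition cut_arrows (cut : {set dart T}) : {set arrow triangulation_quiver} :=
  [set a : arrow triangulation_quiver | angle a \in cut].

End Triangulation.

(* Main.v *)
Require Import Defs.
From HB Require Import structures.
From mathcomp Require Import all_boot all_algebra.
From mathcomp Require Import boolp zify.
From mathcomp Require Import finmap monalg.
From mathcomp Require classical_sets.
Import Defs.

Set Implicit Arguments.
Unset Strict Implicit.
Unset Printing Implicit Defensive.

(** Glue the triangles along the arcs other than the radii. Every puncture has
    valency 1, hence is enclosed in a self-folded triangle, so Euler's formula
    leaves fewer such arcs than triangles: the dual graph is a tree, and every
    arc which is not a radius is a bridge of it. A chordless oriented cycle can
    therefore not leave the triangle of its first arrow; it runs through its three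
    angles, exactly one of which is cut.

    The bound on the global dimension is local. Modulo the arrows of the cut, the
    only relations left are the derivatives [a b + a' b'] along these arrows,
    where [a' b'] is the path through the radius and occurs if the middle side of
    [a b] is a loop. Take [a b] as leading word: no two leading words overlap, as
    the third angle of the triangle is cut. Hence the words without leading
    subword form a basis, and every module M has the resolution
      0 -> (+) C e_(src a) (x) e_(tgt b) M -> (+) C e_(src a) (x) e_(tgt a) M
        -> (+) C e_v (x) e_v M -> M -> 0
    indexed by the leading words [a b], the arrows [a] which are not cut, and the
    vertices [v]. *)

(** * The dual tree *)

Section Combinatorics.
Variable T : triangulated_surface.
Implicit Types (d e u v x : dart T).

(** The dimension bound has to hold for modules of any size, over a ring whose [k]-structure is not
    recorded. Scalars therefore act through the constants of the path algebra, and projectivity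
    rests on [k]-linear sections of surjections, which need Zorn's lemma. The tensor products are
    not formed as quotients: a summand C e (x) e' M is the group of finitely supported functions
    from normal words to e' M, with left multiplication defined by rewriting. As leading words do
    not overlap, a single rewriting at the head suffices, and the relations can be checked directly
    on words. The leading word is the one through the plain side because that side is always a
    vertex, whereas the radius exists only for a loop; a nonzero derivative along a cut arrow then
    has exactly one leading term. Derivatives along the other arrows give nothing new: each of their
    terms contains an arrow at the cut angle of the triangle. *)

Lemma cw_inj : injective (@cw T).
Proof. by move=> d e /(congr1 (cw \o cw)) /=; rewrite !cw3. Qed.
Lemma opp_inj : injective (@opp T). Proof. exact: inv_inj (@oppK T). Qed.
Lemma cwcw_neq d : cw (cw d) != d.
Proof. by apply/eqP => /(congr1 cw); rewrite cw3 => /esym/eqP; apply/negP/cw_neq. Qed.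

Lemma self_folded_cw d : self_folded (cw d) = self_folded d.
Proof. by rewrite /self_folded !cw3 orbA orbC. Qed.

Lemma in_triangle d e : (e \in triangle d) = [|| e == d, e == cw d | e == cw (cw d)].
Proof. by rewrite !inE orbA. Qed.
Lemma triangle_id d : d \in triangle d. Proof. by rewrite in_triangle eqxx. Qed.
Lemma triangle_cw d : triangle (cw d) = triangle d.
Proof. by apply/setP => e; rewrite !in_triangle cw3 orbA orbC. Qed.
Lemma triangle_eq d e : e \in triangle d -> triangle e = triangle d.
Proof. by rewrite in_triangle => /or3P[]/eqP->; rewrite ?triangle_cw. Qed.
Lemma self_folded_triangle d e : e \in triangle d -> self_folded e = self_folded d.
Proof. by rewrite in_triangle => /or3P[]/eqP->; rewrite ?self_folded_cw. Qed.
Lemma cw_triangle d e : (cw e \in triangle d) = (e \in triangle d).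
Proof. by rewrite !in_triangle -[d in cw e == d]cw3 !(inj_eq cw_inj) orbC -orbA. Qed.

Lemma opp_in_triangle d : interior d -> opp d \in triangle d -> self_folded d.
Proof.
rewrite in_triangle /self_folded /interior => /negPf-> /= /orP[/eqP->|/eqP e].
  by rewrite eqxx.
by rewrite -e oppK eqxx !orbT.
Qed.

Lemma interior_opp d : interior (opp d) = interior d.
Proof. by rewrite /interior oppK eq_sym. Qed.
Lemma edge_opp d : edge (opp d) = edge d.
Proof. by rewrite /edge oppK setUC. Qed.
Lemma edge_eq d e : edge d = edge e -> e = d \/ e = opp d.
Proof.
move/setP/(_ e); rewrite !inE eqxx => /orP[/eqP|/eqP]; by [left|right].
Qed.
Lemma edge_id d : d \in edge d. Proof. by rewrite !inE eqxx. Qed.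

Lemma loop_self_folded d e : is_loop d -> e \in triangle (opp d) -> self_folded e.
Proof.
case/andP=> _ dl /self_folded_triangle ->.
by rewrite /self_folded dl !orbT.
Qed.

(** A radius is glued inside a self-folded triangle, so it is never a plain side of a
    non-self-folded one, and it determines the dart of its loop. A plain side determines its dart
    only up to [opp]. *)
Lemma side_eq d r d' r' : ~~ self_folded d -> ~~ self_folded d' ->
  side_ok d r -> side_ok d' r' -> edge (side_dart d r) = edge (side_dart d' r') ->
  r = r' /\ (d' = d \/ r = false /\ d' = opp d).
Proof.
move=> nd nd' /andP[_ dr] /andP[_ dr'].
have rad x y : is_loop x -> y = cw (opp x) \/ y = opp (cw (opp x)) -> self_folded y.
  move=> lx yx; apply: (loop_self_folded lx); case/andP: lx => _ /eqP lx.
  by rewrite lx in yx; case: yx => ->; rewrite !cw_triangle triangle_id.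
case: r r' dr dr' => [] [] //= dr dr' /edge_eq.
- case=> [/cw_inj/opp_inj ->|]; first by split; [|left].
  case/andP: (dr) => _ /eqP ->; move/cw_inj => e; case/negP: nd'.
  by apply: (rad _ _ dr); right; rewrite -[d']oppK e.
- by move/(rad _ _ dr) => sd; rewrite sd in nd'.
- move=> e; case/negP: nd; apply: (rad _ _ dr').
  by case: e => ->; [left | right; rewrite oppK].
- by case=> ->; split=> //; [left|right].
Qed.

(** * Euler's formula and bridges of the dual graph *)

Section Counting.
Hypothesis HS : punctured_polygon T.
Hypothesis H1 : valency1 T.

Lemma same_start_sym : symmetric (@same_start T).
Proof. by move=> d e; rewrite /same_start orbC. Qed.

Lemma start_eq d e : e \in start d -> start e = start d.
Proof.
rewrite inE => de; apply/setP => u; rewrite !inE.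
by apply: esym; apply: (same_connect (sym_connect_sym same_start_sym)).
Qed.

Lemma leq_card_bigcup (I : finType) (P : {set I}) (F : I -> {set dart T}) :
  #|\bigcup_(i in P) F i| <= \sum_(i in P) #|F i|.
Proof.
elim/big_ind2: _ => [|A m B n Am Bn|//]; first by rewrite cards0.
by apply: leq_trans (leq_card_setU _ _) _; apply: leq_add.
Qed.

(** Every dart at a puncture lies on an arc, so valency 1 leaves a single dart [d]; the rotation
    [cw \o opp] around the puncture must then fix it. *)
Lemma puncture_dart (v : {set dart T}) : v \in punctures T ->
  exists2 d, v = [set d] & interior d && (cw (opp d) == d).
Proof.
move=> vP; move: (vP); rewrite inE => /andP[/imsetP[d _ vd] /forall_inP vi].
have dv : d \in v by rewrite vd inE connect0.
have v1 : #|v| <= 1.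
  rewrite -(H1 vP); apply: leq_trans (leq_card_bigcup _ _).
  apply/subset_leq_card/subsetP => e ev; apply/bigcupP; exists (edge e).
    by apply/imsetP; exists e => //; rewrite inE vi.
  by rewrite inE edge_id.
have vE : v = [set d].
  by apply/eqP; rewrite eq_sym eqEcard sub1set dv cards1.
exists d => //; rewrite (vi _ dv) /=.
have : cw (opp d) \in v by rewrite vd inE connect1 // /same_start vi ?eqxx.
by rewrite vE inE.
Qed.

Let bdarts := [set d : dart T | ~~ interior d].
Let radii := [set edge d | d : dart T & interior d && (opp d \in triangle d)].

Lemma card_points : #|points T| <= #|radii| + #|bdarts|.
Proof.
have -> : #|points T| = #|punctures T| + #|points T :\: punctures T|.
  rewrite -[LHS](cardsID (punctures T)); congr (#|pred_of_set _| + _).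
  by apply/setIidPr/subsetP => v; rewrite inE => /andP[].
apply: leq_add.
  pose g (v : {set dart T}) := \bigcup_(d in v) edge d.
  have g1 d : g [set d] = edge d by rewrite /g big_set1.
  (* An arc whose two ends are both such punctures would give [cw (opp d) = d] and [cw d = opp d],
     hence [cw (cw d) = d]. *)
  have g_inj : {in punctures T &, injective g}.
    move=> v w /puncture_dart[d -> /andP[_ /eqP dd]] /puncture_dart[e -> /andP[_ /eqP ee]].
    rewrite !g1 => /edge_eq[->//|e_opp]; case/eqP: (cwcw_neq d).
    by move: ee; rewrite e_opp oppK => ->.
  rewrite -(card_in_imset g_inj) subset_leq_card //; apply/subsetP => A.
  case/imsetP=> v /puncture_dart[d -> /andP[di /eqP dd]] ->; rewrite g1.
  apply/imsetP; exists d => //; rewrite inE di in_triangle -dd.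
  by rewrite cw3 dd eqxx !orbT.
apply: leq_trans (leq_imset_card (@start T) bdarts).
apply/subset_leq_card/subsetP => v; rewrite !inE => /andP[nv vP].
rewrite vP /= negb_forall in nv; have [d] := existsP nv.
rewrite negb_imply => /andP[dv nd]; apply/imsetP; exists d; first by rewrite inE.
by case/imsetP: vP dv => e _ -> /start_eq ->.
Qed.

Lemma card_edges : #|edges T| = #|arcs T| + #|bdarts|.
Proof.
have bd_inj : {in bdarts &, injective (@edge T)}.
  move=> d e; rewrite !inE !negbK => /eqP dd /eqP ee /edge_eq[->//|->].
  by rewrite dd.
rewrite -(card_in_imset bd_inj) -cardsUI.
have -> : arcs T :&: [set edge d | d in bdarts] = set0.
  apply/setP => A; rewrite inE [RHS]inE; apply/negP => /andP[/imsetP[d]].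
  rewrite inE => di -> /imsetP[e]; rewrite inE => ne /edge_eq[] ee.
    by rewrite ee di in ne.
  by rewrite ee interior_opp di in ne.
rewrite cards0 addn0; congr #|pred_of_set _|; apply/setP => A; rewrite inE.
apply/imsetP/orP => [[d _ ->]|]; last by case=> /imsetP[d _ ->]; exists d.
case: (boolP (interior d)) => di; [left|right]; apply/imsetP; exists d => //.
all: by rewrite inE.
Qed.

Variable x : dart T.
Hypothesis xi : interior x.
Hypothesis xn : ~~ self_folded x.

(** Moves inside a triangle and across every arc but that of [x]: the connected classes are the
    components of the dual graph with the edge of [x] removed. *)
Definition walk : rel (dart T) :=
  [rel u v | (v == cw u) || [&& v == opp u, u != x & u != opp x]].

Let good (D : {set dart T}) := [set edge u | u : dart T &
  [&& interior u, u \in D, opp u \in D, opp u \notin triangle u & edge u != edge x]].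
Let tri (D : {set dart T}) := [set triangle u | u in D].

(* Exploring the triangles one by one through the arcs other than that of x, each
   new triangle comes with a new arc. *)
Lemma grow (walk_all : forall d e, connect walk d e) n :
  exists D : {set dart T}, [/\ x \in D, forall u, u \in D -> cw u \in D,
    #|tri D| <= #|good D|.+1 & (D == setT) || (n <= #|D|)].
Proof.
elim: n => [|n [D [xD Dcw Dtri Dn]]].
  exists (triangle x); split; rewrite ?triangle_id ?orbT //.
    by move=> u; rewrite cw_triangle.
  apply: leq_trans (_ : #|[set triangle x]| <= _); last by rewrite cards1.
  apply/subset_leq_card/subsetP => A /imsetP[u ux ->].
  by rewrite inE (triangle_eq ux).
case: (eqVneq D setT) Dn => [DT _|DT /= Dn].
  by exists D; rewrite DT eqxx; split=> //; rewrite -DT.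
have [y yD] : exists y, y \notin D.
  apply/existsP; rewrite -negb_forall; apply: contra DT => /forallP yD.
  by apply/eqP/setP => y; rewrite yD inE.
(* The dart at which a walk from [x] to [y] first leaves [D]; as [D] is closed under [cw], it leaves
   across an arc. *)
have [u [uD vD uv]] : exists u, [/\ u \in D, opp u \notin D & (u != x) && (u != opp x)].
  have exit p z : z \in D -> path walk z p -> last z p \notin D ->
      exists u, [/\ u \in D, opp u \notin D & (u != x) && (u != opp x)].
    elim: p z => [|v p IH] z zD /=; first by rewrite zD.
    case/andP=> zv vp yl; case: (boolP (v \in D)) => vD; first exact: IH vD vp yl.
    exists z; case/orP: zv => [/eqP ev|/and3P[/eqP <- -> ->] //].
    by rewrite ev Dcw in vD.
  by have /connectP[p xp yl] := walk_all x y; apply: (exit p x); rewrite -?yl.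
have vDcw w : w \in D -> w \notin triangle (opp u).
  apply: contraL => /triangle_eq wu; apply: contra vD => wD.
  have : opp u \in triangle w by rewrite wu triangle_id.
  by rewrite in_triangle => /or3P[]/eqP->; rewrite ?Dcw.
have inD' y' : (y' \in D :|: triangle (opp u)) = (y' \in D) || (y' \in triangle (opp u)).
  exact: in_setU.
exists (D :|: triangle (opp u)); split.
- by rewrite inD' xD.
- by move=> w; rewrite !inD' cw_triangle => /orP[/Dcw ->|->]; rewrite ?orbT.
- rewrite {1}/tri imsetU; apply: leq_trans (leq_card_setU _ _) _.
  apply: leq_trans (_ : #|tri D| + 1 <= _).
    rewrite leq_add2l; apply: leq_trans (_ : #|[set triangle (opp u)]| <= _); last by rewrite cards1.
    apply/subset_leq_card/subsetP => A /imsetP[w wu ->].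
    by rewrite inE (triangle_eq wu).
  rewrite addn1 ltnS; apply: leq_trans Dtri _.
  apply: leq_trans (_ : #|edge u |: good D| <= _).
    rewrite cardsU1 -[X in X < _]add0n -add1n leq_add2r lt0b.
    apply/negP => /imsetP[w]; rewrite inE => /and5P[_ wD wD' _ _] /edge_eq[] e.
      by rewrite -e wD' in vD.
    by rewrite -e wD in vD.
  apply/subset_leq_card/subsetP => A; rewrite in_setU1 => /predU1P[->|].
    apply/imsetP; exists u => //; rewrite inE !inD' uD triangle_id !orbT /=.
    have -> : interior u.
      by rewrite /interior; apply: contraNneq vD => ->.
    case/andP: uv => ux uox /=; apply/andP; split.
      apply: contra (vDcw _ uD) => /triangle_eq ->; exact: triangle_id.
    apply/eqP => /edge_eq[] e; first by rewrite e eqxx in ux.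
    by rewrite e oppK eqxx in uox.
  case/imsetP=> w; rewrite inE => /and5P[wi wD wD' wt wx] ->.
  by apply/imsetP; exists w => //; rewrite inE wi !inD' wD wD' wt wx.
- apply/orP; right; apply: leq_ltn_trans Dn _; apply: proper_card.
  apply/properP; split; first exact: subsetUl.
  by exists (opp u); rewrite ?inD' ?triangle_id ?orbT.
Qed.

Lemma walk_cw u : connect walk (cw u) u.
Proof.
apply: connect_trans (connect1 _) (connect1 (_ : walk (cw (cw u)) u)).
  by rewrite /walk /= eqxx.
by rewrite /walk /= cw3 eqxx.
Qed.

Lemma walk_sym : connect_sym walk.
Proof.
have sub u v : connect walk u v -> connect walk v u.
  case/connectP=> p; elim: p u => [|w p IH] u /=; first by move=> _ ->.
  case/andP=> uw wp vl; apply: connect_trans (IH _ wp vl) _.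
  case/orP: uw => [/eqP->|/and3P[/eqP -> ux uox]]; first exact: walk_cw.
  apply: connect1; rewrite /walk /= oppK eqxx (inv_eq (@oppK T)) uox /=.
  by rewrite (inj_eq opp_inj) ux orbT.
by move=> u v; apply/idP/idP; exact: sub.
Qed.

(** If the arc of [x] could be bypassed, the dual graph without it would still be connected, and
    exploring it would use at least [#|triangles T| - 1] arcs that are neither radii nor the arc of
    [x]. Euler's formula allows at most [#|triangles T| - 1] arcs that are not radii, and the arc of
    [x] is one of them. *)
Lemma bridge : ~~ connect walk x (opp x).
Proof.
apply/negP => xx; have [conn euler _] := HS.
have walk_all d e : connect walk d e.
  have /connectP[p] := conn d e; elim: p d => [|u p IH] d /=.
    by move=> _ ->; exact: connect0.
  case/andP=> du up el; apply: connect_trans (IH _ up el).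
  case/orP: du => [/eqP->|/eqP->]; first by apply: connect1; rewrite /walk /= eqxx.
  case: (eqVneq d x) => [->|dx] //.
  case: (eqVneq d (opp x)) => [->|dx']; first by rewrite oppK walk_sym.
  by apply: connect1; rewrite /walk /= eqxx dx dx' orbT.
(* The size asked for exceeds the number of darts, which leaves only the alternative [D == setT]. *)
have [D [_ _ Dtri]] := grow walk_all #|dart T|.+1.
rewrite ltnNge max_card orbF => /eqP DT; rewrite DT in Dtri.
(* The inequality is strict because of the arc of [x]: it is excluded from [good], and it is no
   radius since the triangle of [x] is not self-folded. *)
have gr : #|good setT| + #|radii| < #|arcs T|.
  have xg : edge x \notin good setT :|: radii.
    rewrite in_setU negb_or; apply/andP; split.
      by apply/imsetP => -[u]; rewrite inE => /and5P[_ _ _ _ /eqP ne] /esym.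
    apply/imsetP => -[u]; rewrite inE => /andP[ui uf] /edge_eq ux.
    have su := opp_in_triangle ui uf; case/negP: xn.
    case: ux => ux; first by rewrite -ux.
    by rewrite -[x]oppK -ux (self_folded_triangle uf).
  have <- : #|good setT :|: radii| = #|good setT| + #|radii|.
    rewrite -cardsUI -[LHS]addn0; congr (_ + _); apply/esym/eqP.
    rewrite cards_eq0; apply/eqP/setP => A; rewrite inE [RHS]inE; apply/negP.
    case/andP=> /imsetP[u]; rewrite inE => /and5P[_ _ _ ut _] ->.
    case/imsetP=> w; rewrite inE => /andP[wi wt] /edge_eq[] e.
      by rewrite -e wt in ut.
    rewrite e in wt; case/negP: ut; rewrite oppK in wt.
    by rewrite (triangle_eq wt) triangle_id.
  rewrite -add1n; have := cardsU1 (edge x) (good setT :|: radii); rewrite xg => <-.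
  apply/subset_leq_card/subsetP => A; rewrite !inE => /or3P[/eqP->||].
  - by apply/imsetP; exists x; rewrite ?inE.
  - case/imsetP=> u; rewrite inE => /andP[ui _] ->.
    by apply/imsetP; exists u; rewrite ?inE.
  - case/imsetP=> u; rewrite inE => /andP[ui _] ->.
    by apply/imsetP; exists u; rewrite ?inE.
have trT : #|triangles T| = #|tri setT|.
  by congr #|pred_of_set _|; apply/setP => A; apply/imsetP/imsetP => -[u _ ->]; exists u.
have := card_points; have := card_edges; rewrite -trT in Dtri; lia.
Qed.

End Counting.
End Combinatorics.

(** * Chordless cycles *)

Section TriangulationArrows.
Variable T : triangulated_surface.
Local Notation Q := (triangulation_quiver T).
Implicit Types (d e : dart T) (a b : arrow Q) (r : bool).

(** Whether the source of the arrow is the radius of a loop rather than the side itself; [trad] is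
    the same for the target. *)
Definition srad (a : arrow Q) : bool := (val (a : qarrow T)).1.2.
Definition trad (a : arrow Q) : bool := (val (a : qarrow T)).2.
Local Notation ang a := (angle (a : qarrow T)).

Lemma arrowP a : [/\ ~~ self_folded (ang a), side_ok (ang a) (srad a)
  & side_ok (cw (ang a)) (trad a)].
Proof.
have := valP (a : qarrow T); rewrite /angle /srad /trad.
by case: (val _) => [[d r] r'] /and3P[].
Qed.
Lemma angle_nsf a : ~~ self_folded (ang a). Proof. by case: (arrowP a). Qed.

Lemma arrow_exists d r r' : ~~ self_folded d -> side_ok d r -> side_ok (cw d) r' ->
  exists a, [/\ ang a = d, srad a = r & trad a = r'].
Proof.
move=> nd dr dr'; have ok : is_arrow (d, r, r') by rewrite /= nd dr dr'.
by exists (exist _ (d, r, r') ok : qarrow T).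
Qed.

Lemma arrow_ext a b : ang a = ang b -> srad a = srad b -> trad a = trad b -> a = b.
Proof.
move=> e1 e2 e3; apply: (@val_inj _ _ (qarrow T)).
move: e1 e2 e3; rewrite /angle /srad /trad.
by case: (val _) => [[? ?] ?]; case: (val _) => [[? ?] ?] /= -> -> ->.
Qed.

Lemma val_src a : val (src a : qvertex T) = edge (side_dart (ang a) (srad a)).
Proof. by []. Qed.
Lemma val_tgt a : val (tgt a : qvertex T) = edge (side_dart (cw (ang a)) (trad a)).
Proof. by []. Qed.

Lemma src_src a b : src a = src b -> srad a = srad b /\
  (ang b = ang a \/ srad a = false /\ ang b = opp (ang a)).
Proof.
move/(congr1 (fun v : qvertex T => val v)); rewrite !val_src.
have [n1 s1 _] := arrowP a; have [n2 s2 _] := arrowP b.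
exact: side_eq.
Qed.
Lemma tgt_src a b : tgt a = src b -> trad a = srad b /\
  (ang b = cw (ang a) \/ trad a = false /\ ang b = opp (cw (ang a))).
Proof.
move/(congr1 (fun v : qvertex T => val v)); rewrite val_src val_tgt.
have [n1 _ s1] := arrowP a; have [n2 s2 _] := arrowP b.
by apply: side_eq; rewrite ?self_folded_cw.
Qed.
Lemma tgt_tgt a b : tgt a = tgt b -> trad a = trad b /\
  (cw (ang b) = cw (ang a) \/ trad a = false /\ cw (ang b) = opp (cw (ang a))).
Proof.
move/(congr1 (fun v : qvertex T => val v)); rewrite !val_tgt.
have [n1 _ s1] := arrowP a; have [n2 _ s2] := arrowP b.
by apply: side_eq; rewrite ?self_folded_cw.
Qed.

Lemma src_srcI a b : ang a = ang b -> srad a = srad b -> src a = src b.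
Proof.
by move=> e1 e2; apply: (@val_inj _ _ (qvertex T)); rewrite !val_src e1 e2.
Qed.
Lemma tgt_srcI a b : cw (ang a) = ang b -> trad a = srad b -> tgt a = src b.
Proof.
by move=> e1 e2; apply: (@val_inj _ _ (qvertex T)); rewrite val_src val_tgt e1 e2.
Qed.
Lemma tgt_tgtI a b : ang a = ang b -> trad a = trad b -> tgt a = tgt b.
Proof.
by move=> e1 e2; apply: (@val_inj _ _ (qvertex T)); rewrite !val_tgt e1 e2.
Qed.

Lemma angle_interior a : interior (ang a) && interior (cw (ang a)).
Proof. by have [_ /andP[-> _] /andP[-> _]] := arrowP a. Qed.

Lemma opp_triangle_neq d e e' : ~~ self_folded d -> e \in triangle d ->
  e' \in triangle d -> interior e -> opp e <> e'.
Proof.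
move=> nd ed ed' ei ee; case/negP: nd; rewrite -(self_folded_triangle ed).
by apply: opp_in_triangle => //; rewrite (triangle_eq ed) ee.
Qed.

Section Cycles.
Hypothesis HS : punctured_polygon T.
Hypothesis H1 : valency1 T.

(** Once [c] is rotated to start at [v], this is an induction along the list, which never has to
    come back to [v]. *)
Lemma cycle_ind (S : eqType) (c : seq S) (P : S -> Prop) v : uniq c -> v \in c ->
  P v -> (forall u, u \in c -> P u -> P (next c u)) -> forall u, u \in c -> P u.
Proof.
move=> cu vc Pv Pn u uc; have [i p ep] := rot_to vc.
have next_p w : next c w = next (v :: p) w by rewrite -ep next_rot.
have mem_p w : (w \in c) = (w \in v :: p) by rewrite -ep mem_rot.
have : fcycle (next c) (v :: p).
  have := @cycle_next _ (v :: p); rewrite -{1}ep rot_uniq => /(_ cu).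
  by rewrite (eq_cycle (e' := frel (next c))) // => x y /=; rewrite next_p.
rewrite /= rcons_path => /andP[pp _].
have {mem_p} sub w : w \in v :: p -> w \in c by rewrite mem_p.
move: uc; rewrite -(mem_rot i) ep => uc.
elim: p v Pv pp sub uc {ep next_p vc} => [|w p IH] v Pv /=.
  by move=> _ _; rewrite inE => /eqP->.
case/andP=> /eqP <- pp sub; rewrite inE => /predU1P[-> //|]; apply: IH => //.
  by apply: Pn Pv; apply: sub; rewrite mem_head.
by move=> z zp; apply: sub; rewrite inE zp orbT.
Qed.

(* Consecutive arrows of a cycle stay in the same triangle: otherwise the cycle
   would join the two sides of the arc at which it changes triangles without
   crossing this arc again. *)
Lemma cycle_angle (c : seq (vertex Q)) (f : vertex Q -> arrow Q) : uniq c ->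
  (forall v, v \in c -> src (f v) = v /\ tgt (f v) = next c v) ->
  forall v, v \in c -> ang (f (next c v)) = cw (ang (f v)).
Proof.
move=> cu fP v vc; set w := next c v.
have wc : w \in c by rewrite mem_next.
have [fv1 fv2] := fP v vc; have [fw1 fw2] := fP w wc.
have [rE [//|[r0 oE]]] := tgt_src (etrans fv2 (esym fw1)).
set x := ang (f w) in oE *.
have xi : interior x by have /andP[] := angle_interior (f w).
have xn : ~~ self_folded x := angle_nsf (f w).
have wx : val (w : qvertex T) = edge x.
  by rewrite -[in LHS]fw1 val_src -rE r0.
case/negP: (bridge HS H1 xi xn).
have walkcw u : connect (walk x) u (cw u).
  by apply: connect1; rewrite /walk /= eqxx.
have ox : opp x = cw (ang (f v)) by rewrite oE oppK.
suff : forall u, u \in c -> connect (walk x) x (ang (f u)).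
  by move=> /(_ v vc) xv; apply: connect_trans xv _; rewrite ox; exact: walkcw.
apply: (cycle_ind cu wc) => [|u uc xu]; first exact: connect0.
(* At [w] the walk starts again from [x]. Any other vertex of the cycle is a different arc, so
   moving across it is allowed by [walk x]. *)
have [/eqP un|un] := boolP (next c u == w); first by rewrite un; exact: connect0.
have [fu1 fu2] := fP u uc.
have nuc : next c u \in c by rewrite mem_next.
have [fn1 fn2] := fP _ nuc.
have [sE eE] := tgt_src (etrans fu2 (esym fn1)).
apply: connect_trans xu _; apply: connect_trans (walkcw _) _.
case: eE => [-> //|[t0 eE]]; apply: connect1; rewrite /walk /= eE eqxx /=.
have nux : val (next c u : qvertex T) = edge (cw (ang (f u))).
  by rewrite -fu2 val_tgt t0.
have ne : edge (cw (ang (f u))) != edge x.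
  by apply: contra un => /eqP ex; apply/eqP/(@val_inj _ _ (qvertex T)); rewrite nux ex.
apply/orP; right; apply/andP; split; apply: contra ne => /eqP ->; rewrite ?edge_opp //.
Qed.

(** If [g] shares a dart with the triangle of [d] at one end and is glued to it at the other, the
    triangle is self-folded. If it is glued at both ends, its triangle and that of [d] have two arcs
    in common, and crossing one of them bypasses the other, against [bridge]. *)
Lemma no_chord d (g p q : arrow Q) : ~~ self_folded d ->
  ang p \in triangle d -> ang q \in triangle d -> src g = src p -> tgt g = tgt q ->
  [/\ ang p = ang q, ang g = ang p, srad g = srad p & trad g = trad q].
Proof.
move=> nd pd qd /src_src[sE sgp] /tgt_tgt[tE tgq].
have [gi gci] := andP (angle_interior g).
have [pi pci] := andP (angle_interior p).
have [qi qci] := andP (angle_interior q).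
suff [pg qg] : ang p = ang g /\ ang q = ang g by rewrite qg -pg.
have cqd : cw (ang q) \in triangle d by rewrite cw_triangle.
case: sgp => [pg|[_ pg]]; case: tgq => [/cw_inj qg|[_ qg]] //.
- by case: (@opp_triangle_neq d (cw (ang q)) (cw (ang p))) => //; rewrite ?cw_triangle // qg oppK pg.
- by case: (@opp_triangle_neq d (ang p) (ang q)) => //; rewrite pg oppK qg.
case/negP: (bridge HS H1 pi (angle_nsf p)).
have walkcw u : connect (walk (ang p)) u (cw u).
  by apply: connect1; rewrite /walk /= eqxx.
have walktri e e' : e \in triangle d -> e' \in triangle d -> connect (walk (ang p)) e e'.
  move=> ed; rewrite -(triangle_eq ed) in_triangle => /or3P[]/eqP->.
  - exact: connect0.
  - exact: walkcw.
  - by apply: connect_trans (walkcw _) (walkcw _).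
(* The detour: inside the triangle of [d] to [cw (ang q)], across that arc to [cw (ang g)], then
   inside the triangle of [g] to [ang g], which is [opp (ang p)]. *)
apply: connect_trans (walktri _ _ pd cqd) _.
have og : opp (ang p) = ang g by rewrite pg oppK.
have ogc : opp (cw (ang q)) = cw (ang g) by rewrite qg oppK.
apply: (@connect_trans _ _ (cw (ang g))); last by rewrite og; exact: walk_cw.
apply: connect1; rewrite /walk /= ogc eqxx /=; apply/orP; right.
apply/andP; split; apply/eqP => e.
  by move: ogc; rewrite e og => /esym/eqP; apply/negP/cw_neq.
by case: (@opp_triangle_neq d (ang p) (cw (ang q))).
Qed.

Variable cut : {set dart T}.
Hypothesis Hcut : admissible_cut cut.

Lemma chordless_cut c : chordless_oriented_cycle c ->
  #|cut_arrows cut :&: arrows_on (Q := Q) c| = 1.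
Proof.
case=> cn cu cc.
have [v0 v0c] : exists v, v \in c by case: c cn {cu cc} => // v c _; exists v; rewrite mem_head.
have arrow_of v : v \in c -> exists a : arrow Q, src a = v /\ tgt a = next c v.
  move=> vc; have nvc : next c v \in c by rewrite mem_next.
  have /eqP/cards1P[a aE] : #|[set a : arrow Q | (src a == v) && (tgt a == next c v)]| = 1.
    by rewrite cc // eqxx.
  exists a; have : a \in [set a] by rewrite inE.
  by rewrite -aE inE => /andP[/eqP-> /eqP->].
have [a0 _] := arrow_of v0 v0c.
have [f fP] : exists f : vertex Q -> arrow Q,
    forall v, v \in c -> src (f v) = v /\ tgt (f v) = next c v.
  exists (fun v => odflt a0 [pick a : arrow Q | (src a == v) && (tgt a == next c v)]).
  move=> v vc; case: pickP => [a /andP[/eqP ? /eqP ?] //|no].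
  by have [a [a1 a2]] := arrow_of v vc; have := no a; rewrite a1 a2 !eqxx.
have fU (a : arrow Q) : src a \in c -> tgt a \in c -> a = f (src a).
  move=> sc tc; have := cc _ _ sc tc.
  have aS : a \in [set b : arrow Q | (src b == src a) && (tgt b == tgt a)].
    by rewrite inE !eqxx.
  case: eqP => [tE|_] card; last by rewrite (cardsD1 a) aS in card.
  have [b bE] := cards1P (introT eqP card).
  have [f1 f2] := fP _ sc.
  have fS : f (src a) \in [set b].
    by rewrite -bE inE f1 f2 tE !eqxx.
  by move: aS fS; rewrite bE !inE => /eqP-> /eqP->.
have fang v : v \in c -> ang (f (next c v)) = cw (ang (f v)) by exact: cycle_angle fP v.
set d := ang (f v0); have nd : ~~ self_folded d := angle_nsf (f v0).
have ftri u : u \in c -> ang (f u) \in triangle d.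
  move: u; apply: (cycle_ind cu v0c) => [|u uc ud]; first exact: triangle_id.
  by rewrite fang // cw_triangle.
have v1c : next c v0 \in c by rewrite mem_next.
have v2c : next c (next c v0) \in c by rewrite mem_next.
have id : internal d.
  have /andP[i0 i1] := angle_interior (f v0).
  have /andP[_ i2] := angle_interior (f (next c v0)).
  by rewrite /internal i0 i1 -(fang v0) // i2.
have [e eE] := cards1P (introT eqP (Hcut.2 d id nd)).
have [ecut ed] : e \in cut /\ e \in triangle d.
  by apply/andP; rewrite -in_setI eE inE.
have [w wc we] : exists2 w, w \in c & ang (f w) = e.
  move: ed; rewrite in_triangle => /or3P[]/eqP->.
  - by exists v0.
  - by exists (next c v0) => //; rewrite (fang v0 v0c).
  - by exists (next c (next c v0)) => //; rewrite (fang _ v1c) (fang v0 v0c).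
apply/eqP/cards1P; exists (f w); apply/setP => g; rewrite !inE.
have [w1 w2] := fP w wc.
apply/idP/eqP => [/andP[gcut /andP[sc tc]]|->]; last first.
  by rewrite w1 w2 wc mem_next wc we ecut.
have gE := fU g sc tc.
have ge : ang g = e.
  by apply/set1P; rewrite -eE inE gcut gE ftri.
have [_ sg _] := arrowP g; have [nw _ tw] := arrowP (f w).
have tw' : side_ok (cw (ang g)) (trad (f w)) by rewrite ge -we.
(* Through loops and radii, a cycle might pass the cut angle more than once. The arrow [h] at this
   angle, from the source of [g] to the target of [f w], has both ends on the cycle, so it is the
   arrow of the cycle at [src g]; thus [src g] and [w] have the same successor. *)
have [h [h1 h2 h3]] := arrow_exists (angle_nsf g) sg tw'.
have hs : src h = src g by exact: src_srcI.
have ht : tgt h = tgt (f w) by apply: tgt_tgtI; rewrite ?h1 ?h3 ?ge ?we.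
have hE : h = f (src g) by rewrite -hs; apply: fU; rewrite ?hs ?ht ?w2 ?mem_next.
have nE : next c (src g) = next c w.
  by have [_ <-] := fP _ sc; rewrite -hE ht w2.
have gw : src g = w := can_inj (prev_next cu) nE.
exact: etrans gE (congr1 f gw).
Qed.

Lemma cut_arrow_chordless (a : arrow Q) : a \in cut_arrows cut ->
  exists2 c, chordless_oriented_cycle c & a \in arrows_on (Q := Q) c.
Proof.
rewrite inE => acut; have [/and3P[i0 i1 i2] nd] := andP (Hcut.1 _ acut).
have [_ sa ta] := arrowP a; set d := ang a in acut i0 i1 i2 nd sa ta *.
have nd1 : ~~ self_folded (cw d) by rewrite self_folded_cw.
have nd2 : ~~ self_folded (cw (cw d)) by rewrite !self_folded_cw.
(* The arrow is completed to a 3-cycle through the plain third side, which is available whether or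
   not it is a loop. *)
have ok2 : side_ok (cw (cw d)) false by rewrite /side_ok i2.
have [b [b1 b2 b3]] := arrow_exists nd1 ta ok2.
have sa' : side_ok (cw (cw (cw d))) (srad a) by rewrite cw3.
have [c [c1 c2 c3]] := arrow_exists nd2 ok2 sa'.
have ab : tgt a = src b by exact: tgt_srcI.
have bc : tgt b = src c by apply: tgt_srcI; rewrite ?b1 ?b3.
have ca : tgt c = src a by apply: tgt_srcI; rewrite ?c1 ?cw3.
pose P : seq (arrow Q) := [:: a; b; c].
have PE p : (p \in P) = [|| p == a, p == b | p == c] by rewrite !inE.
have Ptri p : p \in P -> ang p \in triangle d.
  by rewrite PE => /or3P[]/eqP->; rewrite ?b1 ?c1 ?cw_triangle triangle_id.
have n01 : d <> cw d by move/esym/eqP; apply/negP/cw_neq.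
have n02 : d <> cw (cw d) by move/esym/eqP; apply/negP/cwcw_neq.
have n12 : cw d <> cw (cw d) by move/cw_inj.
have Pang : {in P &, forall p q, ang p = ang q -> p = q}.
  move=> p q; rewrite !PE => /or3P[]/eqP-> /or3P[]/eqP->; 
    rewrite ?b1 ?c1 -/d // => /esym //.
have Pchord p q (g : arrow Q) : p \in P -> q \in P -> src g = src p -> tgt g = tgt q ->
    p = q /\ g = p.
  move=> pP qP gs gt; have [e1 e2 e3 e4] := no_chord nd (Ptri p pP) (Ptri q qP) gs gt.
  have pq := Pang p q pP qP e1; split=> //.
  by apply: arrow_ext => //; rewrite e4 pq.
have srcP : {in P &, injective (@src Q)}.
  move=> p q pP qP /src_src[_ [/esym|[_ e]]]; first exact: Pang.
  have [pi _] := andP (angle_interior p).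
  by case: (opp_triangle_neq nd (Ptri p pP) (Ptri q qP) pi).
have cE : [:: src a; src b; src c] = map (@src Q) P by [].
have uP : uniq P.
  rewrite /= !inE negb_or !andbT -andbA.
  by apply/and3P; split; apply/eqP => /(congr1 (fun a => ang a)); rewrite ?b1 ?c1.
exists [:: src a; src b; src c]; last first.
  by rewrite inE ab !inE !eqxx orbT.
split=> //; first by rewrite cE map_inj_in_uniq.
have nextP p : p \in P -> next [:: src a; src b; src c] (src p) = tgt p.
  have us : uniq [:: src a; src b; src c] by rewrite cE map_inj_in_uniq.
  move=> pP; move: us; rewrite /= !inE negb_or !andbT => /andP[/andP[s1 s2] s3].
  move: pP; rewrite PE; case/or3P=> /eqP->; rewrite /next /= ?eqxx ?ab ?bc ?ca //.
    by rewrite [src b == _]eq_sym (negbTE s1).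
  by rewrite [src c == src a]eq_sym (negbTE s2) [src c == _]eq_sym (negbTE s3).
move=> x y; rewrite cE => /mapP[p pP ->] yc.
(* Each vertex of the 3-cycle is also the target of one of its arrows, so [Pchord] covers every
   ordered pair of its vertices. *)
have [q qP ->] : exists2 q, q \in P & y = tgt q.
  move: yc; rewrite !inE => /or3P[]/eqP->.
  - by exists c; rewrite ?PE ?eqxx ?orbT.
  - by exists a; rewrite ?PE ?eqxx ?orbT.
  - by exists b; rewrite ?PE ?eqxx ?orbT.
rewrite -cE nextP //; case: eqP => [/esym e|ne].
  have [<- _] := Pchord p q p pP qP erefl e.
  apply/eqP/cards1P; exists p; apply/setP => g; rewrite !inE.
  apply/andP/eqP => [[/eqP e1 /eqP e2]|-> //].
  by have [] := Pchord p p g pP pP e1 e2.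
apply/eqP; rewrite cards_eq0; apply/eqP/setP => g; rewrite !inE; apply/negP.
case/andP=> /eqP e1 /eqP e2; have [pq _] := Pchord p q g pP qP e1 e2.
by case: ne; rewrite pq.
Qed.

Lemma cut_arrows_admissible : admissible_quiver_cut (cut_arrows cut).
Proof. by split; [exact: chordless_cut | exact: cut_arrow_chordless]. Qed.

End Cycles.

End TriangulationArrows.

Import GRing.Theory.
Local Open Scope ring_scope.

(** * Modules and path algebras *)

Section Splitting.
Variables (k : fieldType) (V W : lmodType k) (g : {linear V -> W}).

(** A subspace on which [g] is injective, except that it may be empty: Zorn's lemma also asks for
    the union of the empty chain. *)
Let indep (U : V -> Prop) : Prop :=
  (forall c x y, U x -> U y -> U (c *: x + y)) /\
  (forall x, U x -> g x = 0 -> x = 0).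

Let indep_max : exists U, indep U /\
  forall U', indep U' -> (forall x, U x -> U' x) -> forall x, U' x -> U x.
Proof.
have [F FP Ftot|U [iU maxU]] := @classical_sets.Zorn_bigcup V indep.
  split=> [c x y [A FA Ax] [B FB By]|x [A FA Ax]]; last exact: (FP A FA).2.
  case: (Ftot A B FA FB) => sub.
    by exists B => //; apply: (FP B FB).1 => //; exact: sub.
  by exists A => //; apply: (FP A FA).1 => //; exact: sub.
exists U; split=> // U' iU' sub x U'x; apply: contrapT => nUx.
by apply: (maxU U') => //; split=> // /(_ x U'x).
Qed.

(** A maximal subspace meeting the kernel trivially maps onto [W], since a vector whose image it
    misses could be added to it; the section is the inverse of [g] on this subspace. *)
Lemma linear_surj_split : (forall y, exists x, g x = y) ->
  exists s : {linear W -> V}, forall y, g (s y) = y.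
Proof.
move=> gs; have [U [[Ulin Uker] Umax]] := indep_max.
(* Emptiness is excluded by maximality. *)
have U0 : U 0.
  apply: (Umax (fun x => U x \/ x = 0)); [split| by left | by right].
    move=> c x y [Ux|->] [Uy|->].
    - by left; exact: Ulin.
    - left; rewrite addr0; have := Ulin (c - 1) x x Ux Ux.
      by rewrite scalerBl scale1r subrK.
    - by left; rewrite scaler0 add0r.
    - by right; rewrite scaler0 addr0.
  by move=> x [Ux|-> //]; exact: Uker.
have UZ c x : U x -> U (c *: x) by move=> Ux; rewrite -[_ *: _]addr0; exact: Ulin.
have gU y : exists x, U x /\ g x = y.
  have [x xy] := gs y.
  have [[u [Uu gu]]|nx] := pselect (exists u, U u /\ g u = g x).
    by exists u; rewrite gu.
  have ind : indep (fun z => exists c u, U u /\ z = c *: x + u).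
    split=> [c z1 z2 [c1 [u1 [U1 ->]]] [c2 [u2 [U2 ->]]]|z [c [u [Uu ->]]]].
      exists (c * c1 + c2), (c *: u1 + u2); split; first exact: Ulin.
      by rewrite scalerDr scalerDl scalerA addrACA.
    rewrite linearD linearZ /= => gz.
    have [c0|c0] := eqVneq c 0.
      by move: gz; rewrite c0 !scale0r !add0r; exact: Uker.
    case: nx; exists (- c^-1 *: u); split; first exact: UZ.
    move/eqP: gz; rewrite addrC addr_eq0 => /eqP gu.
    by rewrite linearZ /= gu scalerN scaleNr opprK scalerA mulVf // scale1r.
  exists x; split=> //; apply: (Umax _ ind).
    by move=> u Uu; exists 0, u; rewrite scale0r add0r.
  by exists 1, 0; rewrite scale1r addr0.
pose s y := projT1 (cid (gU y)).
have sP y : U (s y) /\ g (s y) = y by rewrite /s; case: cid.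
have slin : linear s.
  move=> c x y; apply/eqP; rewrite -subr_eq0; apply/eqP/Uker.
    rewrite [X in U X]addrC -scaleN1r; apply: (Ulin _ _ _ _ (sP _).1).
    exact: Ulin (sP x).1 (sP y).1.
  by rewrite linearB /= linearD linearZ /= !(sP _).2 subrr.
pose sl : {linear W -> V} := HB.pack s (GRing.isLinear.Build _ _ _ _ s slin).
by exists sl => y; exact: (sP y).2.
Qed.

End Splitting.

Section MalgLift.
Variables (K : choiceType) (G V : zmodType).
Implicit Types (F : K -> G -> V) (f g : {malg G[K]}).

(** The coefficients are elements of a group and not scalars, so an additive extension needs a map
    of coefficients for each index. *)
Definition malg_lift F f : V := \sum_(i <- msupp f) F i f@_i.

Section Additive.
Variable F : K -> G -> V.
Hypothesis FD : forall i, {morph F i : x y / x + y}.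

Lemma malg_lift_cst0 i : F i 0 = 0.
Proof. by apply: (addrI (F i 0)); rewrite -FD !addr0. Qed.

Lemma malg_liftEw f (d : {fset K}) : (msupp f `<=` d)%fset ->
  malg_lift F f = \sum_(i <- d) F i f@_i.
Proof.
move=> fd; rewrite /malg_lift (big_fset_incl _ fd) //= => i _ /mcoeff_outdom ->.
exact: malg_lift_cst0.
Qed.

Lemma malg_liftD : {morph malg_lift F : f g / f + g}.
Proof.
move=> f g; have := msuppD_le f g.
rewrite (malg_liftEw (fsubsetUl (msupp f) (msupp g))).
rewrite (malg_liftEw (fsubsetUr (msupp f) (msupp g))) => /malg_liftEw ->.
by rewrite -big_split; apply: eq_bigr => i _; rewrite mcoeffD FD.
Qed.

Lemma malg_liftU i m : malg_lift F << m *g i >> = F i m.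
Proof.
rewrite (malg_liftEw (d := [fset i]%fset)) ?msuppU_le //.
by rewrite big_seq_fset1 mcoeffUU.
Qed.

End Additive.
End MalgLift.

Lemma malg_ind (K : choiceType) (G : zmodType) (P : {malg G[K]} -> Prop) :
  P 0 -> (forall f g, P f -> P g -> P (f + g)) ->
  (forall i m, P << m *g i >>) -> forall f, P f.
Proof. by move=> P0 PD PU f; rewrite (monalgE f); apply: big_ind. Qed.

Lemma malgU_scale (K : choiceType) (R : nzRingType) (c : R) (i : K) :
  << c *g i >> = c *: << i >> :> {malg R[K]}.
Proof. by apply/malgP => j; rewrite [RHS]mcoeffZ !mcoeffU mulrnAr mulr1. Qed.

Lemma morphD0 (U V : zmodType) (f : U -> V) : {morph f : x y / x + y} -> f 0 = 0.
Proof. by move=> fD; apply: (addrI (f 0)); rewrite -fD !addr0. Qed.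

Lemma morphDN (U V : zmodType) (f : U -> V) :
  {morph f : x y / x + y} -> {morph f : x / - x}.
Proof. by move=> fD x; apply: (addrI (f x)); rewrite -fD !subrr (morphD0 fD). Qed.

Lemma morphDsum (U V : zmodType) (f : U -> V) (I : Type) (s : seq I)
    (P : pred I) (F : I -> U) : {morph f : x y / x + y} ->
  f (\sum_(i <- s | P i) F i) = \sum_(i <- s | P i) f (F i).
Proof. by move=> fD; apply: (big_morph f fD (morphD0 fD)). Qed.

(** * Vertices, arrows and scalars inside the path algebra *)

Section PathAlgebraGenerators.
Variables (k : fieldType) (Q : quiver).
Local Notation A := (path_algebra k Q).
Implicit Types (r : A) (a b : arrow Q) (v w : vertex Q) (s t : seq (arrow Q)).

Definition vertE : vertex Q -> A := locked (fun v => pathE k v [::]).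
Definition arrE : arrow Q -> A := locked (fun a => arrowE k a).

Lemma vertEE v : vertE v = pathE k v [::]. Proof. by rewrite /vertE -lock. Qed.
Lemma arrEE a : arrE a = arrowE k a. Proof. by rewrite /arrE -lock. Qed.

Lemma pathE_mul v s w t : composable v s -> composable w t ->
  pathE k v s * pathE k w t =
  if last v [seq tgt a | a <- s] == w then pathE k v (s ++ t) else 0.
Proof.
move=> vs wt; have [p -> [sp ap]] := pathEP k vs.
have [q -> [sq aq]] := pathEP k wt.
rewrite -[LHS]/(linext _ _) linextU linextU /path_mul /target sp ap sq aq.
by [].
Qed.

Lemma vertE_mul v w : vertE v * vertE w = if v == w then vertE v else 0.
Proof. rewrite !vertEE; exact: pathE_mul. Qed.

Lemma vertE_arrow v a : vertE v * arrE a = if v == src a then arrE a else 0.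
Proof.
by rewrite vertEE arrEE /arrowE pathE_mul //= ?eqxx //; case: eqP => // ->.
Qed.

Lemma arrow_vertE a v : arrE a * vertE v = if tgt a == v then arrE a else 0.
Proof. by rewrite vertEE arrEE /arrowE pathE_mul //= eqxx. Qed.

Lemma arrow_path a s : composable (tgt a) s ->
  arrE a * pathE k (tgt a) s = pathE k (src a) (a :: s).
Proof. by move=> sP; rewrite arrEE /arrowE pathE_mul //= ?eqxx. Qed.

Lemma arrow_arrow a b : tgt a = src b ->
  arrE a * arrE b = pathE k (src a) [:: a; b].
Proof.
by move=> ab; rewrite [arrE b]arrEE [arrowE k b]/arrowE -ab arrow_path //= ab eqxx.
Qed.

Lemma pa_scalel c r r' : (c *: r) * r' = c *: (r * r').
Proof. exact: linextZ. Qed.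

Lemma pa_scaler c r r' : r * (c *: r') = c *: (r * r').
Proof.
rewrite -[LHS]/(linext _ _) -[r * r']/(linext _ _) /linext scaler_sumr.
apply: eq_bigr => p _; rewrite -[in LHS]/(linext _ _) linextZ.
by rewrite !scalerA mulrC.
Qed.

(** Scalars as elements of the path algebra: its quotient is a bare ring, and [k] acts on the
    modules through the images of these constants. *)
Definition pa_const : k -> A := locked (fun c => c *: (1 : A)).

Lemma pa_constE c : pa_const c = c *: (1 : A). Proof. by rewrite /pa_const -lock. Qed.

Lemma pa_constD c d : pa_const (c + d) = pa_const c + pa_const d.
Proof. rewrite !pa_constE; exact: scalerDl. Qed.

Lemma pa_const1 : pa_const 1 = 1.
Proof. rewrite pa_constE; exact: scale1r. Qed.

Lemma pa_const_mul c r : pa_const c * r = c *: r.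
Proof. by rewrite pa_constE pa_scalel mul1r. Qed.

Lemma mul_pa_const c r : r * pa_const c = c *: r.
Proof. by rewrite pa_constE pa_scaler mulr1. Qed.

Lemma pa_constM c d : pa_const c * pa_const d = pa_const (c * d).
Proof. rewrite pa_const_mul !pa_constE; exact: scalerA. Qed.

Lemma pa_path_scale c (p : qpath Q) : << c *g p >> = c *: (<< p >> : A).
Proof. exact: malgU_scale. Qed.

Lemma pa_ind (P : A -> Prop) : P 0 -> (forall r r', P r -> P r' -> P (r + r')) ->
  (forall c v s, composable v s -> P (c *: pathE k v s)) -> forall r, P r.
Proof.
move=> P0 PD PU; apply: malg_ind => // p c; rewrite pa_path_scale -pathE_val.
by apply: PU; exact: valP p.
Qed.

Lemma pa_one_sum : 1 = \sum_v vertE v :> A.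
Proof. by under eq_bigr do rewrite vertEE. Qed.

End PathAlgebraGenerators.

(** * Quadratic algebras without overlaps *)

Section QuadraticPresentation.
Variables (k : fieldType) (Q : quiver).
Local Notation A := (path_algebra k Q).
(* [lead a b]: the word [a b] is the leading term of a relation, the other terms of
   which are the words [x.1 x.2] for [x] in [tail a b]. *)
Variables (live : pred (arrow Q)) (lead : rel (arrow Q)).
Variable (tail : arrow Q -> arrow Q -> seq (arrow Q * arrow Q)).

Definition quadratic_relation a b : A :=
  arrE k a * arrE k b + \sum_(x <- tail a b) arrE k x.1 * arrE k x.2.

Definition quadratic_relations (r : A) : Prop :=
  (exists a b, lead a b /\ r = quadratic_relation a b) \/
  (exists2 a, ~~ live a & r = arrE k a).

Hypothesis leadP : forall a b, lead a b -> [/\ live a, live b & tgt a = src b].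
Hypothesis tailP : forall a b x, lead a b -> x \in tail a b ->
  [/\ live x.1 && live x.2, src x.1 = src a, tgt x.1 = src x.2, tgt x.2 = tgt b
    & ~~ lead x.1 x.2].
(** Leading words overlap neither each other nor a word of a tail, so replacing a leading word by
    its tail creates no new leading word. *)
Hypothesis lead_lead : forall a b c, lead a b -> ~~ lead b c.
Hypothesis tail_lead : forall a b c x, lead a b -> x \in tail a b -> ~~ lead x.2 c.
Hypothesis lead_tail : forall a b c x, lead a b -> x \in tail a b -> ~~ lead c x.1.

Variables (C : pzRingType) (pi : {rmorphism A -> C}).
Hypothesis pi_surj : forall c, exists r, pi r = c.
Hypothesis pi_rel : forall r, quadratic_relations r -> pi r = 0.
Hypothesis pi_ker : forall r, pi r = 0 -> two_sided_ideal quadratic_relations r.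

Implicit Types (r : A) (a b : arrow Q) (v w : vertex Q) (s t : seq (arrow Q)).

Definition pi_inv (c : C) : A := projT1 (cid (pi_surj c)).
Lemma pi_invK c : pi (pi_inv c) = c. Proof. by rewrite /pi_inv; case: cid. Qed.

(** * Modules over the presented algebra *)

Section Action.
Variable N : lmodType C.
Implicit Types (x y n : N).

Definition kact (c : k) n : N := pi (pa_const Q c) *: n.
Definition vact v n : N := pi (vertE k v) *: n.
Definition aact a n : N := pi (arrE k a) *: n.
Fixpoint wact s n : N := if s is a :: s' then aact a (wact s' n) else n.

Lemma kactD c : {morph kact c : x y / x + y}. Proof. exact: scalerDr. Qed.
Lemma vactD v : {morph vact v : x y / x + y}. Proof. exact: scalerDr. Qed.
Lemma aactD a : {morph aact a : x y / x + y}. Proof. exact: scalerDr. Qed.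
Lemma wactD s : {morph wact s : x y / x + y}.
Proof. by elim: s => //= a s IH x y; rewrite IH aactD. Qed.

Lemma kactDl c d n : kact (c + d) n = kact c n + kact d n.
Proof. by rewrite /kact pa_constD rmorphD scalerDl. Qed.
Lemma kactA c d n : kact c (kact d n) = kact (c * d) n.
Proof. by rewrite /kact scalerA -rmorphM pa_constM. Qed.
Lemma kact1 n : kact 1 n = n.
Proof. by rewrite /kact pa_const1 rmorph1 scale1r. Qed.

Lemma pi_kact c r n : pi (c *: r) *: n = kact c (pi r *: n).
Proof. by rewrite /kact scalerA -rmorphM pa_const_mul. Qed.
Lemma kact_pi c r n : pi r *: kact c n = kact c (pi r *: n).
Proof. by rewrite -pi_kact /kact scalerA -rmorphM mul_pa_const. Qed.
Lemma kact_vact c v n : vact v (kact c n) = kact c (vact v n).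
Proof. exact: kact_pi. Qed.
Lemma kact_aact c a n : aact a (kact c n) = kact c (aact a n).
Proof. exact: kact_pi. Qed.
Lemma kact_wact c s n : wact s (kact c n) = kact c (wact s n).
Proof. by elim: s => //= a s ->; rewrite kact_aact. Qed.

Lemma vactA v w n : vact v (vact w n) = if v == w then vact v n else 0.
Proof.
rewrite /vact scalerA -rmorphM vertE_mul; case: eqP => // _.
by rewrite rmorph0 scale0r.
Qed.
Lemma vactK v n : vact v (vact v n) = vact v n.
Proof. by rewrite vactA eqxx. Qed.
Lemma vact_aact v a n : vact v (aact a n) = if v == src a then aact a n else 0.
Proof.
rewrite /vact /aact scalerA -rmorphM vertE_arrow; case: eqP => // _.
by rewrite rmorph0 scale0r.
Qed.
Lemma aact_vact a v n : aact a (vact v n) = if tgt a == v then aact a n else 0.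
Proof.
rewrite /vact /aact scalerA -rmorphM arrow_vertE; case: eqP => // _.
by rewrite rmorph0 scale0r.
Qed.
Lemma vact_sum n : \sum_v vact v n = n.
Proof. by rewrite -scaler_suml -rmorph_sum -pa_one_sum rmorph1 scale1r. Qed.

Lemma aact_dead a n : ~~ live a -> aact a n = 0.
Proof.
by move=> la; rewrite /aact pi_rel ?scale0r //; right; exists a.
Qed.
Lemma aact_rel a b n : lead a b ->
  aact a (aact b n) + \sum_(x <- tail a b) aact x.1 (aact x.2 n) = 0.
Proof.
move=> ab; rewrite -[RHS](scale0r n).
rewrite -(pi_rel (r := quadratic_relation a b)); last by left; exists a, b.
rewrite /quadratic_relation rmorphD rmorphM rmorph_sum scalerDl -scalerA.
rewrite scaler_suml; congr (_ + _); apply: eq_bigr => x _.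
by rewrite rmorphM -scalerA.
Qed.

Lemma kactN c : {morph kact c : x / - x}. Proof. exact: scalerN. Qed.
Lemma kact0 c : kact c 0 = 0. Proof. exact: scaler0. Qed.
Lemma vactN c : {morph vact c : x / - x}. Proof. exact: scalerN. Qed.
Lemma vact0 c : vact c 0 = 0. Proof. exact: scaler0. Qed.
Lemma aactN c : {morph aact c : x / - x}. Proof. exact: scalerN. Qed.
Lemma aact0 c : aact c 0 = 0. Proof. exact: scaler0. Qed.
Lemma wact0 s : wact s 0 = 0. Proof. exact: morphD0 (wactD s). Qed.

End Action.

Lemma aact_pathE (N : lmodType C) v s (n : N) : composable v s ->
  pi (pathE k v s) *: n = vact v (wact s n).
Proof.
elim: s v => [|a s IH] v; first by rewrite /vact vertEE.
move=> /= /andP[/eqP av sP].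
by rewrite -av -arrow_path // rmorphM -scalerA IH // vact_aact eqxx -/(aact _ _)
  aact_vact eqxx.
Qed.

(** The images of scalars, vertices and arrows generate [C] as a ring. *)
Lemma equivariant_linear (N1 N2 : lmodType C) (f : N1 -> N2) :
  {morph f : x y / x + y} ->
  (forall c x, f (kact c x) = kact c (f x)) ->
  (forall v x, f (vact v x) = vact v (f x)) ->
  (forall a x, f (aact a x) = aact a (f x)) -> linear f.
Proof.
move=> fD fk fv fa c x y; rewrite fD; congr (_ + _).
rewrite -(pi_invK c); move: (pi_inv c); apply: pa_ind => [|r r' IHr IHr'|d v s vs].
- by rewrite rmorph0 !scale0r (morphD0 fD).
- by rewrite rmorphD !scalerDl fD IHr IHr'.
rewrite !pi_kact fk !aact_pathE // fv.
by congr (kact _ (vact _ _)); elim: s {vs} => //= a s IH; rewrite fa IH.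
Qed.

Lemma linear_wact (N1 N2 : lmodType C) (f : {linear N1 -> N2}) s x :
  f (wact s x) = wact s (f x).
Proof. by elim: s => //= a s <-; rewrite /aact linearZ. Qed.

(** An alias of [N] to carry the [k]-module structure next to the [C]-module structure. *)
Definition kmod (N : lmodType C) : Type := N.
HB.instance Definition _ (N : lmodType C) := GRing.Zmodule.on (kmod N).

Section RestrictScalars.
Variable N : lmodType C.
Definition kmod_scale (c : k) (x : kmod N) : kmod N := kact c (x : N).
Lemma kmod_scaleA c d x : kmod_scale c (kmod_scale d x) = kmod_scale (c * d) x.
Proof. exact: kactA. Qed.
Lemma kmod_scale1 : left_id 1 kmod_scale.
Proof. by move=> x; exact: kact1. Qed.
Lemma kmod_scaleDr : right_distributive kmod_scale +%R.
Proof. by move=> c x y; exact: kactD. Qed.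
Lemma kmod_scaleDl x : {morph kmod_scale^~ x : c d / c + d}.
Proof. by move=> c d; exact: kactDl. Qed.
HB.instance Definition _ := GRing.Zmodule_isLmodule.Build k (kmod N)
  kmod_scaleA kmod_scale1 kmod_scaleDr kmod_scaleDl.
End RestrictScalars.

Lemma restrict_surj_split (N1 N2 : lmodType C) (g : {linear N1 -> N2}) :
  (forall y, exists x, g x = y) ->
  exists s : N2 -> N1, [/\ {morph s : x y / x + y},
    forall c x, s (kact c x) = kact c (s x) & forall y, g (s y) = y].
Proof.
move=> gs.
have gl : linear (g : kmod N1 -> kmod N2).
  move=> c x y; rewrite linearD; congr (_ + _).
  exact: (linearZ_LR g (pi (pa_const Q c)) x).
pose gk : {linear kmod N1 -> kmod N2} := HB.pack (g : kmod N1 -> kmod N2)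
  (GRing.isLinear.Build _ _ _ _ (g : kmod N1 -> kmod N2) gl).
have [s sK] := @linear_surj_split k (kmod N1) (kmod N2) gk gs.
exists s; split=> //; first by move=> x y; exact: (linearD s x y).
move=> c x; exact: (linearZ_LR s c x).
Qed.

(* The module (+)_j C e_(sJ j) (x) e_(tJ j) M. The element [m] at index [(s, j)] stands
   for s (x) m, where [s] is a normal word which ends at [sJ j]. *)
Section WordModule.
Variables (M : lmodType C) (J : choiceType) (sJ tJ : J -> vertex Q).
Local Notation X := {malg M[(seq (arrow Q) * J)%type]}.
Implicit Types (x y : X) (j : J) (m : M) (i : seq (arrow Q) * J).

Definition leads a s : bool := if s is b :: _ then lead a b else false.
Definition wsource s v := if s is a :: _ then src a else v.
Fixpoint normal s v : bool := if s is a :: s' then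
  [&& live a, tgt a == wsource s' v, ~~ leads a s' & normal s' v] else true.

(** The projection [vact (tJ j)] to e_(tJ j) M accounts for the tensor product over the vertices. A
    word which is not normal gives 0, not its reduction. *)
Definition word : seq (arrow Q) -> J -> M -> X := locked (fun s j m =>
  if normal s (sJ j) then << vact (tJ j) m *g (s, j) >> else 0).
Lemma wordE s j m :
  word s j m = if normal s (sJ j) then << vact (tJ j) m *g (s, j) >> else 0.
Proof. by rewrite /word -lock. Qed.

Lemma wordD s j : {morph word s j : m m' / m + m'}.
Proof.
move=> m m'; rewrite [LHS]wordE [X in _ = X + _]wordE [X in _ = _ + X]wordE.
rewrite vactD monalgUD; case: ifP => // _; rewrite addr0.
by [].
Qed.

Lemma word_vact s j m : word s j (vact (tJ j) m) = word s j m.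
Proof. by rewrite !wordE vactK. Qed.

Definition xvert : vertex Q -> X -> X := locked (fun v =>
  malg_lift (fun i m => if wsource i.1 (sJ i.2) == v then word i.1 i.2 m else 0)).
Lemma xvertE v : xvert v = malg_lift
  (fun i m => if wsource i.1 (sJ i.2) == v then word i.1 i.2 m else 0).
Proof. by rewrite /xvert -lock. Qed.

(* Left multiplication by [a], rewriting the leading word which may appear at the
   head; the words of its tail are then already in normal form. *)
Definition xstep a s j m : X := if leads a s then
  - \sum_(y <- if s is b :: s' then [seq [:: z.1, z.2 & s'] | z <- tail a b]
      else [::]) word y j m
  else word (a :: s) j m.

Definition xarrow : arrow Q -> X -> X := locked (fun a =>
  malg_lift (fun i m => xstep a i.1 i.2 m)).
Lemma xarrowE a : xarrow a = malg_lift (fun i m => xstep a i.1 i.2 m).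
Proof. by rewrite /xarrow -lock. Qed.

Definition xscale : k -> X -> X := locked (fun c =>
  malg_lift (fun i m => << kact c m *g i >>)).
Lemma xscaleE c : xscale c = malg_lift (fun i m => << kact c m *g i >>).
Proof. by rewrite /xscale -lock. Qed.

Lemma xstepD a s j : {morph xstep a s j : m m' / m + m'}.
Proof.
move=> m m'; rewrite /xstep; case: ifP => _; last exact: wordD.
rewrite -opprD -big_split; congr (- _); apply: eq_bigr => y _.
exact: wordD.
Qed.

Lemma xvertD v : {morph xvert v : x y / x + y}.
Proof.
by rewrite xvertE; apply: malg_liftD => i m m'; case: ifP => _; rewrite ?wordD ?addr0.
Qed.
Lemma xarrowD a : {morph xarrow a : x y / x + y}.
Proof. rewrite xarrowE; apply: malg_liftD => i; exact: xstepD. Qed.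
Lemma xscaleD c : {morph xscale c : x y / x + y}.
Proof. by rewrite xscaleE; apply: malg_liftD => i m m'; rewrite kactD monalgUD. Qed.

Lemma xvertU v s j m : xvert v << m *g (s, j) >> =
  if wsource s (sJ j) == v then word s j m else 0.
Proof.
by rewrite xvertE malg_liftU // => i m1 m2; case: ifP => _; rewrite ?wordD ?addr0.
Qed.
Lemma xarrowU a s j m : xarrow a << m *g (s, j) >> = xstep a s j m.
Proof. rewrite xarrowE malg_liftU // => i; exact: xstepD. Qed.
Lemma xscaleU c i m : xscale c << m *g i >> = << kact c m *g i >>.
Proof. by rewrite xscaleE malg_liftU // => ? ? ?; rewrite kactD monalgUD. Qed.

Lemma xvert_word v s j m :
  xvert v (word s j m) = if wsource s (sJ j) == v then word s j m else 0.
Proof.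
rewrite [in LHS]wordE; case: ifP => sj; first by rewrite xvertU word_vact.
by rewrite (morphD0 (xvertD v)) wordE sj if_same.
Qed.

Lemma xscale_word c s j m : xscale c (word s j m) = word s j (kact c m).
Proof.
rewrite !wordE; case: ifP => sj; last exact: (morphD0 (xscaleD c)).
by rewrite xscaleU kact_vact.
Qed.

(** The second letters of a leading word and of a word in its tail end at the same vertex and begin
    no leading word, so they put the same condition on [s]. *)
Lemma normal_tail a b s v z : lead a b -> z \in tail a b ->
  normal [:: z.1, z.2 & s] v = normal (b :: s) v.
Proof.
move=> ab zab; have [/andP[l1 l2] _ e2 e3 n4] := tailP ab zab.
have [_ lb _] := leadP ab.
rewrite /= l1 l2 lb e2 e3 eqxx /= n4 /= ; congr (_ && (_ && _)).
case: s => //= c s; rewrite (negbTE (tail_lead c ab zab)).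
by rewrite (negbTE (lead_lead c ab)).
Qed.

Lemma xstep_vact a s j m : xstep a s j (vact (tJ j) m) = xstep a s j m.
Proof.
rewrite /xstep; case: ifP => _; last exact: word_vact.
by congr (- _); apply: eq_bigr => y _; rewrite word_vact.
Qed.

Lemma xarrow_word a s j m : xarrow a (word s j m) = xstep a s j m.
Proof.
rewrite [in LHS]wordE; case: ifP => sj; first by rewrite xarrowU xstep_vact.
rewrite (morphD0 (xarrowD a)) /xstep; case: ifP => as_; last first.
  by rewrite wordE /= sj !andbF.
case: s sj as_ => //= b s sj ab; rewrite big_map big_seq big1 ?oppr0 // => z zab.
by rewrite wordE (normal_tail s _ ab zab) /= sj.
Qed.

Lemma xarrow_vert a v x : xarrow a (xvert v x) = if tgt a == v then xarrow a x else 0.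
Proof.
move: x; apply: malg_ind => [|x y|[s j] m].
- by rewrite (morphD0 (xvertD v)) (morphD0 (xarrowD a)) if_same.
- by rewrite xvertD !xarrowD => -> ->; case: ifP => _ //; rewrite addr0.
rewrite xvertU xarrowU.
case: (eqVneq (wsource s (sJ j)) v) => sv; first rewrite xarrow_word.
  case: ifP => // av; rewrite /xstep; case: ifP => as_; last first.
    by rewrite wordE /= sv av andbF.
  case: s as_ sv => //= b s ab bv; case/negP: av.
  by have [_ _ ->] := leadP ab; rewrite bv.
rewrite (morphD0 (xarrowD a)); case: eqP => // av; rewrite /xstep.
case: ifP => as_; last first.
  by rewrite wordE /= av eq_sym (negbTE sv) andbF.
case: s as_ sv => //= b s ab /eqP bv; case: bv.
by have [_ _ <-] := leadP ab.
Qed.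

Lemma xvert_arrow v a x : xvert v (xarrow a x) = if v == src a then xarrow a x else 0.
Proof.
move: x; apply: malg_ind => [|x y|[s j] m].
- by rewrite (morphD0 (xarrowD a)) (morphD0 (xvertD v)) if_same.
- by rewrite xarrowD xvertD => -> ->; case: ifP => _ //; rewrite addr0.
rewrite xarrowU /xstep; case: ifP => as_; last by rewrite xvert_word eq_sym.
rewrite (morphDN (xvertD v)) (morphDsum _ _ _ (xvertD v)).
case: s as_ => //= b s ab; rewrite !big_map.
transitivity (- \sum_(z <- tail a b) if v == src a then
   word [:: z.1, z.2 & s] j m else 0).
  congr (- _); rewrite !big_seq; apply: eq_bigr => z zab.
  by rewrite xvert_word /=; have [_ -> _ _ _] := tailP ab zab; rewrite eq_sym.
by case: eqP => // _; rewrite big1 ?oppr0.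
Qed.

Lemma xvertA v w x : xvert v (xvert w x) = if v == w then xvert v x else 0.
Proof.
move: x; apply: malg_ind => [|x y|[s j] m].
- by rewrite !(morphD0 (xvertD _)) if_same.
- by rewrite !xvertD => -> ->; case: ifP => _ //; rewrite addr0.
rewrite !xvertU; case: (eqVneq _ w) => [<-|sw].
  by rewrite xvert_word eq_sym; case: eqP.
by rewrite (morphD0 (xvertD v)); case: (eqVneq v w) => // ->; rewrite (negbTE sw).
Qed.

Lemma xscale_vert c v x : xvert v (xscale c x) = xscale c (xvert v x).
Proof.
move: x; apply: malg_ind => [|x y|[s j] m].
- by rewrite !(morphD0 (xscaleD _)) !(morphD0 (xvertD _)) (morphD0 (xscaleD _)).
- by rewrite xscaleD !xvertD xscaleD => -> ->.
rewrite xscaleU !xvertU; case: ifP => _; last by rewrite (morphD0 (xscaleD c)).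
by rewrite xscale_word.
Qed.

Lemma xscale_arrow c a x : xarrow a (xscale c x) = xscale c (xarrow a x).
Proof.
move: x; apply: malg_ind => [|x y|[s j] m].
- by rewrite (morphD0 (xscaleD _)) !(morphD0 (xarrowD _)) (morphD0 (xscaleD _)).
- by rewrite xscaleD !xarrowD xscaleD => -> ->.
rewrite xscaleU !xarrowU /xstep; case: ifP => as_; last by rewrite xscale_word.
rewrite (morphDN (xscaleD c)) (morphDsum _ _ _ (xscaleD c)); congr (- _).
by apply: eq_bigr => y _; rewrite xscale_word.
Qed.

Lemma xscaleA c d x : xscale c (xscale d x) = xscale (c * d) x.
Proof.
move: x; apply: malg_ind => [|x y|i m].
- by rewrite !(morphD0 (xscaleD _)).
- by rewrite !xscaleD => -> ->.
by rewrite !xscaleU kactA.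
Qed.

Lemma xscale1 x : xscale 1 x = x.
Proof.
move: x; apply: malg_ind => [|x y|i m].
- by rewrite !(morphD0 (xscaleD _)).
- by rewrite !xscaleD => -> ->.
by rewrite !xscaleU kact1.
Qed.

Lemma xscaleDl c d x : xscale (c + d) x = xscale c x + xscale d x.
Proof.
move: x; apply: malg_ind => [|x y|i m].
- by rewrite !(morphD0 (xscaleD _)) addr0.
- by rewrite !xscaleD => -> ->; rewrite addrACA.
by rewrite !xscaleU kactDl monalgUD.
Qed.

Lemma xarrow_dead a x : ~~ live a -> xarrow a x = 0.
Proof.
move=> da; move: x; apply: malg_ind => [|x y|[s j] m].
- by rewrite !(morphD0 (xarrowD _)).
- by rewrite !xarrowD => -> ->; rewrite addr0.
rewrite xarrowU /xstep; case: ifP => as_; last by rewrite wordE /= (negbTE da).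
by case: s as_ => //= b s /leadP[la]; rewrite la in da.
Qed.

Lemma xstep_nlead a s j m : ~~ leads a s -> xstep a s j m = word (a :: s) j m.
Proof. by rewrite /xstep => /negbTE ->. Qed.

(** After [b], multiplying by [a] rewrites [a b] into minus its tail. Neither [b] nor the second
    letter of a tail begins a leading word, so nothing else is rewritten and the terms cancel. *)
Lemma xarrow_rel a b x : lead a b ->
  xarrow a (xarrow b x) + \sum_(z <- tail a b) xarrow z.1 (xarrow z.2 x) = 0.
Proof.
move=> ab; move: x; apply: malg_ind => [|x y IHx IHy|[s j] m].
- rewrite big1 => [|z _]; by rewrite !(morphD0 (xarrowD _)) ?addr0.
- rewrite !xarrowD; under eq_bigr do rewrite !xarrowD.
  by rewrite big_split addrACA IHx IHy addr0.
rewrite xarrowU xstep_nlead; last by case: s => //= c s; exact: lead_lead ab.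
rewrite xarrow_word /xstep /= ab big_map.
apply/eqP; rewrite addrC subr_eq0; apply/eqP; rewrite !big_seq.
apply: eq_bigr => z zab; rewrite xarrowU xstep_nlead; last first.
  by case: s => //= c s; exact: tail_lead ab zab.
by rewrite xarrow_word xstep_nlead //; have [] := tailP ab zab.
Qed.

Fixpoint xword s x : X := if s is a :: s' then xarrow a (xword s' x) else x.

Lemma xwordD s : {morph xword s : x y / x + y}.
Proof. by elim: s => //= a s IH x y; rewrite IH xarrowD. Qed.

Lemma xword_cat s t x : xword (s ++ t) x = xword s (xword t x).
Proof. by elim: s => //= a s ->. Qed.

Lemma xscale_word_act c s x : xword s (xscale c x) = xscale c (xword s x).
Proof. by elim: s => //= a s ->; rewrite xscale_arrow. Qed.

Lemma xvert_path v s w x : composable v s ->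
  xvert v (xword s (xvert w x)) =
  if last v [seq tgt a | a <- s] == w then xvert v (xword s x) else 0.
Proof.
elim: s v => [|a s IH] v /=; first by rewrite xvertA.
case/andP=> /eqP av sP; rewrite !xvert_arrow -av eqxx.
have aE z : xarrow a z = xarrow a (xvert (tgt a) z) by rewrite xarrow_vert eqxx.
rewrite aE (IH _ sP); case: ifP => _; first by rewrite -aE.
exact: morphD0 (xarrowD a).
Qed.

Definition xact : A -> X -> X := locked (fun r x =>
  malg_lift (fun p c => xscale c (xvert (source p) (xword (arrows p) x))) r).
Lemma xactE r x : xact r x =
  malg_lift (fun p c => xscale c (xvert (source p) (xword (arrows p) x))) r.
Proof. by rewrite /xact -lock. Qed.

Lemma xactDl x : {morph xact^~ x : r r' / r + r'}.
Proof. move=> r r' /=; rewrite !xactE malg_liftD // => p c d; exact: xscaleDl. Qed.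

Lemma xactD r : {morph xact r : x y / x + y}.
Proof.
move=> x y; rewrite !xactE /malg_lift -big_split; apply: eq_bigr => p _.
by rewrite xwordD xvertD xscaleD.
Qed.

Lemma xact_scale_path c v s x : composable v s ->
  xact (c *: pathE k v s) x = xscale c (xvert v (xword s x)).
Proof.
move=> vs; have [p -> [<- <-]] := pathEP k vs.
rewrite -pa_path_scale xactE malg_liftU // => q d e; exact: xscaleDl.
Qed.

Lemma xact_path v s x : composable v s ->
  xact (pathE k v s) x = xvert v (xword s x).
Proof. by move=> vs; rewrite -[pathE k v s]scale1r xact_scale_path // xscale1. Qed.

Lemma xactM r r' x : xact (r * r') x = xact r (xact r' x).
Proof.
have x0 y : xact 0 y = 0 by exact: morphD0 (xactDl y).
move: r; apply: pa_ind => [|r1 r2 IH1 IH2|c v s vs].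
- by rewrite mul0r !x0.
- rewrite mulrDl [LHS]xactDl [RHS]xactDl; congr (_ + _).
  + exact: IH1.
  + exact: IH2.
move: r'; apply: pa_ind => [|r1 r2 IH1 IH2|d w t wt].
- by rewrite mulr0 !x0 (morphD0 (xactD _)).
- rewrite mulrDr [LHS]xactDl [xact (r1 + r2) x]xactDl [RHS]xactD; congr (_ + _).
  + exact: IH1.
  + exact: IH2.
rewrite pa_scalel pa_scaler.
rewrite [RHS]xact_scale_path // [X in xword s X]xact_scale_path //.
rewrite xscale_word_act xscale_vert xvert_path // pathE_mul //.
case: ifP => stw; last first.
  rewrite (scaler0 (path_algebra k Q)) (scaler0 (path_algebra k Q)) x0.
  by rewrite !(morphD0 (xscaleD _)).
have -> := scalerA c d (pathE k v (s ++ t)).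
rewrite [LHS]xact_scale_path ?xword_cat ?xscaleA //.
by rewrite composable_cat vs (eqP stw).
Qed.

Lemma xact_arrow a x : xact (arrE k a) x = xarrow a x.
Proof.
by rewrite arrEE /arrowE xact_path /= ?eqxx // xvert_arrow eqxx.
Qed.

Lemma xact_vert v x : xact (vertE k v) x = xvert v x.
Proof. by rewrite vertEE xact_path. Qed.

Lemma xact_const c x : xact (pa_const Q c) x = xscale c (xact 1 x).
Proof.
have x0 y : xact 0 y = 0 by exact: morphD0 (xactDl y).
rewrite pa_constE pa_one_sum (scaler_sumr (V := path_algebra k Q)).
rewrite !(morphDsum _ _ _ (xactDl x)) (morphDsum _ _ _ (xscaleD c)).
by apply: eq_bigr => v _; rewrite vertEE xact_scale_path // xact_path.
Qed.

Lemma xact_ideal r x : two_sided_ideal quadratic_relations r -> xact r x = 0.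
Proof.
move=> I; elim: I x => {r} [r [[a [b [ab ->]]]|[a da ->]]||r r' _ IH _ IH'|r r' _ IH|r r' _ IH] x.
- rewrite xactDl xactM !xact_arrow (morphDsum _ _ _ (xactDl x)).
  under eq_bigr do rewrite xactM !xact_arrow.
  exact: xarrow_rel.
- by rewrite xact_arrow xarrow_dead.
- exact: morphD0 (xactDl x).
- by rewrite xactDl (morphDN (xactDl x)) IH IH' subr0.
- by rewrite xactM IH (morphD0 (xactD _)).
- by rewrite xactM IH.
Qed.

(** This makes the action of [C] through the chosen preimages [pi_inv] independent of their
    choice. *)
Lemma xact_eq r r' x : pi r = pi r' -> xact r x = xact r' x.
Proof.
move=> e; apply/eqP; rewrite -subr_eq0 -(morphDN (xactDl x)) -xactDl.
by rewrite xact_ideal //; apply: pi_ker; rewrite rmorphB e subrr.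
Qed.

Lemma xact1_word s j m : xact 1 (word s j m) = word s j m.
Proof.
rewrite pa_one_sum (morphDsum _ _ _ (xactDl _)).
under eq_bigr do rewrite xact_vert xvert_word eq_sym.
by rewrite -big_mkcond big_pred1_eq.
Qed.

Lemma xact1E x : xact 1 x = malg_lift (fun i m => word i.1 i.2 m) x.
Proof.
have wD (i : seq (arrow Q) * J) := @wordD i.1 i.2.
move: x; apply: malg_ind => [|x y IHx IHy|[s j] m].
- by rewrite (morphD0 (xactD 1)) (morphD0 (malg_liftD wD)).
- by rewrite xactD malg_liftD // IHx IHy.
rewrite malg_liftU // pa_one_sum (morphDsum _ _ _ (xactDl _)).
under eq_bigr do rewrite xact_vert xvertU eq_sym.
by rewrite -big_mkcond big_pred1_eq.
Qed.

(** The full group also contains functions at words which are not normal, or with values outside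
    e_(tJ j) M. There [xact 1] is not the identity but the projection onto the span of the elements
    [word s j m]; its image is the wanted module. *)
Definition punital : {pred X} := fun x => xact 1 x == x.

Lemma punital_zmod : zmod_closed punital.
Proof.
split=> [|x y]; rewrite !unfold_in; first by rewrite (morphD0 (xactD 1)).
by move=> /eqP xx /eqP yy; rewrite xactD (morphDN (xactD 1)) xx yy.
Qed.
HB.instance Definition _ := GRing.isZmodClosed.Build X punital punital_zmod.

Record pmod := Pmod { pval : X; pvalP : pval \in punital }.
Arguments pval : simpl never.
HB.instance Definition _ := [isSub for pval].
HB.instance Definition _ := [Choice of pmod by <:].
HB.instance Definition _ := [SubChoice_isSubZmodule of pmod by <:].

Lemma pval_unital (x : pmod) : xact 1 (pval x) = pval x.
Proof. by apply/eqP; have := pvalP x; rewrite unfold_in. Qed.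

Lemma pact_subproof r (x : pmod) : xact r (pval x) \in punital.
Proof. by rewrite unfold_in -xactM mul1r. Qed.
Definition pscale (c : C) (x : pmod) : pmod := Pmod (pact_subproof (pi_inv c) x).

Lemma pval_inj : injective pval. Proof. exact: val_inj. Qed.
Lemma pval_pscale c (x : pmod) : pval (pscale c x) = xact (pi_inv c) (pval x).
Proof. by []. Qed.
Lemma pvalD : {morph pval : x y / x + y}. Proof. by []. Qed.

Lemma pscaleA c d (x : pmod) : pscale c (pscale d x) = pscale (c * d) x.
Proof.
apply: pval_inj; rewrite !pval_pscale -xactM; apply: xact_eq.
by rewrite rmorphM !pi_invK.
Qed.
Lemma pscale1 : left_id 1 pscale.
Proof.
move=> x; apply: pval_inj; rewrite pval_pscale -[RHS]pval_unital; apply: xact_eq.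
by rewrite pi_invK rmorph1.
Qed.
Lemma pscaleDr : right_distributive pscale +%R.
Proof. by move=> c x y; apply: pval_inj; rewrite pvalD !pval_pscale pvalD xactD. Qed.
Lemma pscaleDl (x : pmod) : {morph pscale^~ x : c d / c + d}.
Proof.
move=> c d; apply: pval_inj; rewrite pvalD !pval_pscale -xactDl; apply: xact_eq.
by rewrite rmorphD !pi_invK.
Qed.
HB.instance Definition _ :=
  GRing.Zmodule_isLmodule.Build C pmod pscaleA pscale1 pscaleDr pscaleDl.

Lemma pvalZ r (x : pmod) : pval (pi r *: x) = xact r (pval x).
Proof. by apply: xact_eq; rewrite pi_invK. Qed.

Lemma gen_subproof j m : word [::] j m \in punital.
Proof. by rewrite unfold_in xact1_word. Qed.
Definition gen j m : pmod := Pmod (gen_subproof j m).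

Lemma pval_aact a (x : pmod) : pval (aact a x) = xarrow a (pval x).
Proof. by rewrite [LHS]pvalZ xact_arrow. Qed.
Lemma pval_vact v (x : pmod) : pval (vact v x) = xvert v (pval x).
Proof. by rewrite [LHS]pvalZ xact_vert. Qed.
Lemma pval_kact c (x : pmod) : pval (kact c x) = xscale c (pval x).
Proof. by rewrite [LHS]pvalZ xact_const pval_unital. Qed.

Lemma pval_gen j m : pval (gen j m) = word [::] j m. Proof. by []. Qed.

Lemma genD j : {morph gen j : m m' / m + m'}.
Proof. by move=> m m'; apply: pval_inj; exact: wordD. Qed.
Lemma gen_vact j m : gen j (vact (tJ j) m) = gen j m.
Proof. by apply: pval_inj; exact: word_vact. Qed.
Lemma vact_gen j m : vact (sJ j) (gen j m) = gen j m.
Proof. by apply: pval_inj; rewrite pval_vact pval_gen xvert_word eqxx. Qed.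
Lemma kact_gen c j m : kact c (gen j m) = gen j (kact c m).
Proof. by apply: pval_inj; rewrite pval_kact !pval_gen xscale_word. Qed.

Lemma pval_word s j m : normal s (sJ j) -> pval (wact s (gen j m)) = word s j m.
Proof.
elim: s => //= a s IH /and4P[_ _ as_ sN]; rewrite pval_aact IH //.
by rewrite xarrow_word xstep_nlead.
Qed.

Lemma pmod_ind (P : pmod -> Prop) :
  P 0 -> (forall x y : pmod, P x -> P y -> P (x + y)) ->
  (forall s j m, normal s (sJ j) -> P (wact s (gen j m))) -> forall x : pmod, P x.
Proof.
move=> P0 PD Pw x.
have -> : x = \sum_(i <- msupp (pval x)) if normal i.1 (sJ i.2)
    then wact i.1 (gen i.2 (pval x)@_i) else 0.
  apply: pval_inj; rewrite (morphDsum _ _ _ pvalD) -[LHS]pval_unital xact1E.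
  apply: eq_bigr => -[s j] _ /=; case: ifP => sN; first by rewrite pval_word.
  by rewrite wordE sN.
by apply: big_ind => // -[s j] _ /=; case: ifP => //; exact: Pw.
Qed.

(** Existence in the universal property of C e (x) e' M: a [k]-linear map from e' M to e N extends
    to a [C]-linear map by letting the normal words act on its values. *)
Lemma pmod_lift (N : lmodType C) (phi : J -> M -> N) :
  (forall j, {morph phi j : m m' / m + m'}) ->
  (forall j m, phi j (vact (tJ j) m) = phi j m) ->
  (forall j m, vact (sJ j) (phi j m) = phi j m) ->
  (forall c j m, phi j (kact c m) = kact c (phi j m)) ->
  exists f : {linear pmod -> N}, forall j m, f (gen j m) = phi j m.
Proof.
move=> phiD phit phis phik.
pose F s j m := if normal s (sJ j) then wact s (phi j m) else 0.
have FD i : {morph (fun m => F i.1 i.2 m) : m m' / m + m'}.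
  by move=> m m'; rewrite /F; case: ifP => _; rewrite ?addr0 // phiD wactD.
pose L : X -> N := locked (malg_lift (fun i m => F i.1 i.2 m)).
have LE : L = malg_lift (fun i m => F i.1 i.2 m) by rewrite /L -lock.
have LD : {morph L : x y / x + y} by rewrite LE; exact: malg_liftD.
have L0 := morphD0 LD.
have LU s j m : L << m *g (s, j) >> = F s j m by rewrite LE malg_liftU.
have Fvact s j m : F s j (vact (tJ j) m) = F s j m by rewrite /F phit.
have Lw s j m : L (word s j m) = F s j m.
  rewrite wordE; case: ifP => sN; first by rewrite LU.
  by rewrite L0 /F sN.
have Lk c x : L (xscale c x) = kact c (L x).
  move: x; apply: malg_ind => [|x y IHx IHy|[s j] m].
  - by rewrite (morphD0 (xscaleD c)) L0 kact0.
  - by rewrite xscaleD !LD IHx IHy kactD.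
  rewrite xscaleU !LU /F; case: ifP => _; last by rewrite kact0.
  by rewrite phik kact_wact.
have Lv v x : L (xvert v x) = vact v (L x).
  move: x; apply: malg_ind => [|x y IHx IHy|[s j] m].
  - by rewrite (morphD0 (xvertD v)) L0 vact0.
  - by rewrite xvertD !LD IHx IHy vactD.
  rewrite xvertU LU; transitivity (if wsource s (sJ j) == v then F s j m else 0).
    by case: ifP => _; rewrite ?Lw ?L0.
  rewrite /F; case: (normal s (sJ j)); last by rewrite if_same vact0.
  case: s => [|a s] /=; last by rewrite vact_aact eq_sym.
  rewrite -[in RHS]phis vactA eq_sym; case: eqP => // ->.
  by rewrite phis.
have src_phi s j m : vact (wsource s (sJ j)) (wact s (phi j m)) = wact s (phi j m).
  by case: s => [|a s]; rewrite /= ?phis // vact_aact eqxx.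
have La a x : L (xarrow a x) = aact a (L x).
  move: x; apply: malg_ind => [|x y IHx IHy|[s j] m].
  - by rewrite (morphD0 (xarrowD a)) L0 aact0.
  - by rewrite xarrowD !LD IHx IHy aactD.
  rewrite xarrowU LU /xstep; case: ifP => as_.
    case: s as_ => //= b s ab; rewrite big_map (morphDN LD) (morphDsum _ _ _ LD).
    rewrite /F; case: ifP => sN; last first.
      rewrite aact0 big_seq big1 ?oppr0 // => z zab; rewrite Lw /F.
      by rewrite (normal_tail s _ ab zab) sN.
    (* The rewriting done by [xstep] is respected because the relation holds in [N]. *)
    apply/eqP; rewrite eq_sym -addr_eq0; apply/eqP.
    rewrite -[RHS](aact_rel (wact s (phi j m)) ab); congr (_ + _).
    rewrite !big_seq; apply: eq_bigr => z zab.
    by rewrite Lw /F (normal_tail s _ ab zab) sN.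
  rewrite Lw /F /= as_ /=; case: (normal s (sJ j)); last by rewrite !andbF aact0.
  rewrite !andbT; case: (boolP (live a)) => [_|/aact_dead -> //] /=.
  by rewrite -[in RHS]src_phi aact_vact; case: eqP.
have lin : linear (fun x : pmod => L (pval x)).
  apply: equivariant_linear => [x y|c x|v x|a x].
  - by rewrite pvalD LD.
  - by rewrite pval_kact Lk.
  - by rewrite pval_vact Lv.
  - by rewrite pval_aact La.
pose f : {linear pmod -> N} := HB.pack (fun x : pmod => L (pval x))
  (GRing.isLinear.Build _ _ _ _ (fun x : pmod => L (pval x)) lin).
by exists f => j m; rewrite [LHS]Lw.
Qed.

(** A [k]-linear section [s] of [g] suffices: each generator goes to the component of
    [s (h (gen j m))] at its vertex, and [g] respects this component. *)
Lemma pmod_projective : projective_module pmod.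
Proof.
move=> N1 N2 g h gs; have [s [sD sk sK]] := restrict_surj_split gs.
have hv v (x : pmod) : h (vact v x) = vact v (h x) by exact: linearZ_LR.
have hk c (x : pmod) : h (kact c x) = kact c (h x) by exact: linearZ_LR.
have gv v (x : N1) : g (vact v x) = vact v (g x) by exact: linearZ_LR.
have [|j m|j m|c j m|f fE] := @pmod_lift N1 (fun j m => vact (sJ j) (s (h (gen j m)))).
- by move=> j m m'; rewrite genD linearD sD vactD.
- by rewrite gen_vact.
- by rewrite vactK.
- by rewrite -kact_gen hk sk kact_vact.
exists f; apply: pmod_ind => [|x y IHx IHy|t j m _].
- by rewrite !linear0.
- by rewrite !linearD IHx IHy.
by rewrite !linear_wact fE gv sK -hv vact_gen.
Qed.

End WordModule.

(** * The resolution of a module and its exactness *)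

Section Resolution.
Variable M : lmodType C.
Implicit Types m : M.

Let J1 := {a : arrow Q | live a}.
Let J2 := {x : arrow Q * arrow Q | lead x.1 x.2}.
Let s1 (u : J1) := src (val u).
Let t1 (u : J1) := tgt (val u).
Let s2 (u : J2) := src (val u).1.
Let t2 (u : J2) := tgt (val u).2.
Local Notation P0 := (pmod M (@id (vertex Q)) (@id (vertex Q))).
Local Notation P1 := (pmod M s1 t1).
Local Notation P2 := (pmod M s2 t2).
Local Notation gen0 := (@gen M (vertex Q) (@id (vertex Q)) (@id (vertex Q))).

(** Extended by 0 to the arrows which are not live, so that formulas need no proofs of liveness. *)
Definition gen1 a m : P1 := if insub a is Some u then gen s1 t1 u m else 0.

Lemma gen1E (u : J1) m : gen1 (val u) m = gen s1 t1 u m.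
Proof. by rewrite /gen1 valK. Qed.
Lemma gen1D a : {morph gen1 a : m m' / m + m'}.
Proof. by move=> m m'; rewrite /gen1; case: insub => [u|]; rewrite ?genD ?addr0. Qed.
Lemma gen1_0 a : gen1 a 0 = 0. Proof. exact: morphD0 (gen1D a). Qed.
Lemma gen1_vact a v m : gen1 a (vact v m) = if tgt a == v then gen1 a m else 0.
Proof.
rewrite /gen1; case: insubP => [u _ <-|_]; last by rewrite if_same.
rewrite -gen_vact vactA; case: eqP => [_|_]; first by rewrite gen_vact.
by have := gen1_0 (val u); rewrite gen1E.
Qed.
Lemma vact_gen1 a m : vact (src a) (gen1 a m) = gen1 a m.
Proof.
rewrite /gen1; case: insubP => [u _ <-|_]; last by rewrite vact0.
exact: vact_gen.
Qed.
Lemma kact_gen1 c a m : kact c (gen1 a m) = gen1 a (kact c m).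
Proof. by rewrite /gen1; case: insub => [u|]; rewrite ?kact_gen ?kact0. Qed.

Lemma aug_exists : exists f : {linear P0 -> M}, forall v m, f (gen0 v m) = vact v m.
Proof.
apply: pmod_lift => [v m m'|v m|v m|c v m].
- by rewrite vactD.
- by rewrite vactK.
- by rewrite vactK.
- by rewrite kact_vact.
Qed.
Definition aug : {linear P0 -> M} := projT1 (cid aug_exists).
Lemma aug_gen v m : aug (gen0 v m) = vact v m.
Proof. by rewrite /aug; case: cid => f /= ->. Qed.

(** The standard differential a (x) m - 1 (x) a m. *)
Definition diff1_gen (u : J1) m : P0 :=
  aact (val u) (gen0 (tgt (val u)) m) - gen0 (src (val u)) (aact (val u) m).
Lemma diff1_exists : exists f : {linear P1 -> P0},
  forall u m, f (gen s1 t1 u m) = diff1_gen u m.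
Proof.
apply: pmod_lift => [u m m'|u m|u m|c u m]; rewrite /diff1_gen /t1 /s1.
- by rewrite genD aactD aactD genD opprD addrACA.
- by rewrite (@gen_vact M _ _ id) aact_vact eqxx.
- by rewrite vactD vactN vact_aact eqxx (@vact_gen M _ id).
- by rewrite kactD kactN -kact_aact !kact_gen -kact_aact.
Qed.
Definition diff1 : {linear P1 -> P0} := projT1 (cid diff1_exists).
Lemma diff1_genE u m : diff1 (gen s1 t1 u m) = diff1_gen u m.
Proof. by rewrite /diff1; case: cid => f /= ->. Qed.

(** The Fox derivative of the word [x.1 x.2], applied to [m]; [diff2] sends a relation to the sum of
    those of its words. *)
Definition diff2_term (x : arrow Q * arrow Q) m : P1 :=
  aact x.1 (gen1 x.2 m) + gen1 x.1 (aact x.2 m).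
Lemma diff2_termD x : {morph diff2_term x : m m' / m + m'}.
Proof. by move=> m m'; rewrite /diff2_term gen1D !aactD gen1D addrACA. Qed.
Lemma diff2_term_vact x m : diff2_term x (vact (tgt x.2) m) = diff2_term x m.
Proof. by rewrite /diff2_term gen1_vact aact_vact eqxx. Qed.
Lemma vact_diff2_term x m : vact (src x.1) (diff2_term x m) = diff2_term x m.
Proof. by rewrite /diff2_term vactD vact_aact eqxx vact_gen1. Qed.
Lemma kact_diff2_term c x m : kact c (diff2_term x m) = diff2_term x (kact c m).
Proof. by rewrite /diff2_term kactD -kact_aact !kact_gen1 -kact_aact. Qed.

Definition diff2_gen (u : J2) m : P1 := diff2_term (val u) m +
  \sum_(x <- tail (val u).1 (val u).2) diff2_term x m.
Lemma diff2_exists : exists f : {linear P2 -> P1},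
  forall u m, f (gen s2 t2 u m) = diff2_gen u m.
Proof.
apply: pmod_lift => [u m m'|u m|u m|c u m]; rewrite /diff2_gen.
- rewrite diff2_termD [RHS]addrACA; congr (_ + _).
  by rewrite -big_split; apply: eq_bigr => x _; rewrite diff2_termD.
- rewrite diff2_term_vact; congr (_ + _); rewrite !big_seq.
  apply: eq_bigr => x xu; rewrite -[RHS]diff2_term_vact.
  by have [_ _ _ -> _] := tailP (valP u) xu.
- rewrite vactD vact_diff2_term (morphDsum _ _ _ (@vactD _ _)); congr (_ + _).
  rewrite !big_seq; apply: eq_bigr => x xu; rewrite -[RHS]vact_diff2_term.
  by have [_ -> _ _ _] := tailP (valP u) xu.
- rewrite kactD kact_diff2_term (morphDsum _ _ _ (@kactD _ _)); congr (_ + _).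
  by apply: eq_bigr => x _; rewrite kact_diff2_term.
Qed.
Definition diff2 : {linear P2 -> P1} := projT1 (cid diff2_exists).
Lemma diff2_genE u m : diff2 (gen s2 t2 u m) = diff2_gen u m.
Proof. by rewrite /diff2; case: cid => f /= ->. Qed.

(** The element 1 (x) m, which gives an additive section of [aug]. *)
Definition unit0 m : P0 := \sum_v gen0 v m.
Lemma unit0D : {morph unit0 : m m' / m + m'}.
Proof.
by move=> m m'; rewrite /unit0 -big_split; apply: eq_bigr => v _; exact: genD.
Qed.
Lemma aug_unit0 m : aug (unit0 m) = m.
Proof. by rewrite linear_sum -[RHS]vact_sum; apply: eq_bigr => v _; exact: aug_gen. Qed.

Lemma gen0_vact v w m : gen0 v (vact w m) = if v == w then gen0 v m else 0.
Proof.
rewrite -(@gen_vact M _ id id) vactA; case: eqP => _; first exact: gen_vact.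
exact: morphD0 (genD _ _ _).
Qed.
Lemma unit0_vact v m : unit0 (vact v m) = gen0 v m.
Proof.
rewrite /unit0; under eq_bigr do rewrite gen0_vact.
by rewrite -big_mkcond big_pred1_eq.
Qed.
Lemma unit0_aact a m : unit0 (aact a m) = gen0 (src a) (aact a m).
Proof.
by rewrite -unit0_vact vact_aact eqxx.
Qed.
Lemma aact_unit0 a m : aact a (unit0 m) = aact a (gen0 (tgt a) m).
Proof.
rewrite (morphDsum _ _ _ (@aactD _ a)) (bigD1 (tgt a)) //= big1 ?addr0 // => v va.
by rewrite -(@vact_gen M _ id id) aact_vact eq_sym (negbTE va).
Qed.

(* The Fox derivative, sending a_1 ... a_n (x) m to the sum of the
   a_1 ... a_(i-1) (x) a_i (x) a_(i+1) ... a_n m. It is a contracting homotopy up to the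
   image of [diff2]. *)
Fixpoint fox_word s m : P1 :=
  if s is a :: s' then aact a (fox_word s' m) + gen1 a (wact s' m) else 0.
Lemma fox_wordD s : {morph fox_word s : m m' / m + m'}.
Proof.
elim: s => [|a s IH] m m' /=; first by rewrite addr0.
by rewrite IH aactD wactD gen1D addrACA.
Qed.

Let fox_coeff (i : seq (arrow Q) * vertex Q) m : P1 :=
  if normal i.1 i.2 then fox_word i.1 (vact i.2 m) else 0.
Let fox_coeffD i : {morph fox_coeff i : m m' / m + m'}.
Proof.
move=> m m'; rewrite /fox_coeff; case: ifP => _; last by rewrite addr0.
by rewrite vactD fox_wordD.
Qed.
Definition fox_raw : {malg M[(seq (arrow Q) * vertex Q)%type]} -> P1 :=
  locked (malg_lift fox_coeff).
Lemma fox_rawD : {morph fox_raw : x y / x + y}.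
Proof. rewrite /fox_raw -lock; exact: malg_liftD fox_coeffD. Qed.
Lemma fox_raw_word s v m : fox_raw (word id id s v m) = fox_coeff (s, v) m.
Proof.
rewrite wordE; case: ifP => sN; last first.
  by rewrite (morphD0 fox_rawD) /fox_coeff /= sN.
by rewrite /fox_raw -lock malg_liftU ?/fox_coeff /= ?sN ?vactK.
Qed.
Definition fox (x : P0) : P1 := fox_raw (pval x).
Lemma foxD : {morph fox : x y / x + y}.
Proof. by move=> x y; rewrite /fox pvalD fox_rawD. Qed.
Lemma fox_wact s v m : normal s v ->
  fox (wact s (gen0 v m)) = fox_word s (vact v m).
Proof. by move=> sN; rewrite /fox pval_word // fox_raw_word /fox_coeff /= sN. Qed.

Lemma aug_wact s v m : aug (wact s (gen0 v m)) = wact s (vact v m).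
Proof. by rewrite linear_wact aug_gen. Qed.

Lemma diff1_gen1 a m : live a ->
  diff1 (gen1 a m) = aact a (gen0 (tgt a) m) - gen0 (src a) (aact a m).
Proof. by move=> la; rewrite -[a]/(val (Sub a la : J1)) gen1E diff1_genE. Qed.

(** The letters of a word cross the tensor sign one at a time, and the sum telescopes. An element
    killed by [aug] is therefore [diff1] of its Fox derivative. *)
Lemma diff1_fox x : diff1 (fox x) = x - unit0 (aug x).
Proof.
move: x; apply: pmod_ind => [|x y IHx IHy|s v m sN].
- by rewrite (morphD0 foxD) !linear0 (morphD0 unit0D) subrr.
- by rewrite foxD !linearD IHx IHy /= unit0D opprD addrACA.
rewrite fox_wact // aug_wact.
elim: s sN => [|a s IH] /=; first by rewrite linear0 unit0_vact subrr.
case/and4P=> la _ _ /IH IHs.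
rewrite linearD diff1_gen1 // [diff1 (aact _ _)](linearZ_LR diff1) IHs.
rewrite -/(aact _ _) aactD aactN aact_unit0 unit0_aact addrA; congr (_ - _).
by rewrite subrK.
Qed.

Lemma aug_diff1 y : aug (diff1 y) = 0.
Proof.
move: y; apply: pmod_ind => [|x y IHx IHy|s u m _].
- by rewrite !linear0.
- by rewrite !linearD IHx IHy /= addr0.
rewrite !linear_wact diff1_genE /diff1_gen linearB /= (linearZ_LR aug) !aug_gen.
by rewrite -/(aact _ _) vact_aact aact_vact !eqxx subrr wact0.
Qed.

Lemma diff1_diff2 z : diff1 (diff2 z) = 0.
Proof.
move: z; apply: pmod_ind => [|x y IHx IHy|s u m _].
- by rewrite !linear0.
- by rewrite !linearD IHx IHy /= addr0.
have term x : live x.1 -> live x.2 -> tgt x.1 = src x.2 ->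
    diff1 (diff2_term x m) = aact x.1 (aact x.2 (gen0 (tgt x.2) m))
      - gen0 (src x.1) (aact x.1 (aact x.2 m)).
  move=> l1 l2 e; rewrite /diff2_term linearD [diff1 (aact _ _)](linearZ_LR diff1).
  rewrite !diff1_gen1 // -/(aact _ _) aactD aactN e addrA; congr (_ - _).
  by rewrite subrK.
have [l1 l2 e] := leadP (valP u).
rewrite !linear_wact diff2_genE /diff2_gen linearD linear_sum /= term //.
rewrite big_seq; under eq_bigr => x xu.
  have [/andP[k1 k2] es ex et _] := tailP (valP u) xu.
  rewrite term // et es; over.
rewrite -big_seq big_split /= addrACA aact_rel ?(valP u) // add0r sumrN -opprD.
rewrite -(morphDsum _ _ _ (genD _ _ _)) -genD aact_rel ?(valP u) //.
by rewrite (morphD0 (genD _ _ _)) oppr0 wact0.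
Qed.

Lemma cancel_relation (V : zmodType) (p q r s t : V) :
  p + s = 0 -> - (s + t) = p + q + r - (q + r + t).
Proof.
move/eqP; rewrite addr_eq0 => /eqP ->.
by rewrite -[- s + q + r]addrA; move: (q + r) => u; rewrite !opprD addrA addrK.
Qed.

(** The Fox derivative is read off normal words. Multiplying by [a] may create a leading word, and
    rewriting it changes the derivative by that of the relation; hence the Leibniz rule holds only
    up to [diff2]. *)
Lemma fox_aact a x : live a ->
  exists z, fox (aact a x) = aact a (fox x) + gen1 a (aug x) + diff2 z.
Proof.
move=> la; move: x.
apply: pmod_ind => [|x y [z1 IH1] [z2 IH2]|s v m sN].
- exists 0; rewrite aact0 !linear0 (morphD0 foxD) aact0.
  by rewrite (morphD0 (gen1D _)) !addr0.
- exists (z1 + z2); rewrite aactD !foxD IH1 IH2 !linearD /= aactD gen1D.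
  move: (aact a (fox x)) (aact a (fox y)) (gen1 a (aug x)) (gen1 a (aug y)).
  move: (diff2 z1) (diff2 z2) => D1 D2 A1 A2 B1 B2.
  rewrite [LHS]addrACA (addrACA A1 A2 B1 B2); reflexivity.
rewrite fox_wact // aug_wact /fox pval_aact pval_word // xarrow_word.
rewrite /xstep; set m' := vact v m; case: ifP => as_.
  case: s sN as_ => //= b s sN ab; have u : J2 by exists (a, b).
  (* Minus the generator of the relation led by [a b], carrying the rest of the word on the module
     side. *)
  exists (- gen s2 t2 (exist _ (a, b) ab) (wact s m')).
  rewrite linearN /= diff2_genE /diff2_gen /=.
  rewrite big_map (morphDN fox_rawD) (morphDsum _ _ _ fox_rawD).
  transitivity (- \sum_(x <- tail a b)
      (aact x.1 (aact x.2 (fox_word s m')) + diff2_term x (wact s m'))).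
    congr (- _); rewrite !big_seq; apply: eq_bigr => x xab.
    rewrite fox_raw_word /fox_coeff (normal_tail s v ab xab) /= sN.
    by rewrite aactD /diff2_term addrA.
  rewrite big_split /= aactD; have ab_rel := aact_rel (fox_word s m') ab.
  exact: (cancel_relation _ _ _ ab_rel).
exists 0; rewrite linear0 addr0 fox_raw_word /fox_coeff /= la as_ sN /=.
rewrite andbT -/m'; case: eqP => // sa.
have src_w : vact (wsource s v) (wact s m') = wact s m'.
  by case: s {sN as_ sa} => [|b s]; rewrite /= ?vactK // vact_aact eqxx.
have src_f : vact (wsource s v) (fox_word s m') = fox_word s m'.
  case: s {sN as_ sa src_w} => [|b s]; rewrite /= ?vact0 //.
  by rewrite vactD vact_aact eqxx vact_gen1.
by rewrite -src_w -src_f aact_vact gen1_vact; case: eqP => // _; rewrite addr0.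
Qed.

(** This is exactness at [P1]. Each letter in front of the generator adds an error in the image of
    [diff2], while the middle term of the Leibniz rule dies by [aug_diff1]. *)
Lemma fox_diff1 y : exists z, fox (diff1 y) = y + diff2 z.
Proof.
move: y; apply: pmod_ind => [|x y [z1 IH1] [z2 IH2]|s u m _].
- by exists 0; rewrite !linear0 (morphD0 foxD) addr0.
- by exists (z1 + z2); rewrite !linearD foxD IH1 IH2 addrACA.
elim: s => [|a s [z IH]] /=.
  have [z zE] := fox_aact (gen0 (tgt (val u)) m) (valP u); exists z.
  rewrite diff1_genE /diff1_gen foxD (morphDN foxD) zE aug_gen.
  have fox0 v n : fox (gen0 v n) = 0 by exact: (fox_wact (s := [::])).
  by rewrite !fox0 aact0 add0r subr0 gen1_vact eqxx gen1E.
have [la|/aact_dead da] := boolP (live a); last first.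
  by exists 0; rewrite da !linear0 (morphD0 foxD) addr0.
rewrite [diff1 (aact _ _)](linearZ_LR diff1) -/(aact _ _).
have [z' ->] := fox_aact (diff1 (wact s (gen s1 t1 u m))) la.
exists (aact a z + z'); rewrite IH aug_diff1 gen1_0 addr0 aactD -addrA.
by rewrite linearD [diff2 (aact _ _)](linearZ_LR diff2).
Qed.

Lemma normal_rcons s a v : normal s (src a) -> live a -> tgt a = v ->
  (forall b, ~~ lead b a) -> normal (rcons s a) v.
Proof.
move=> sN la av ba; elim: s sN => [|b s IH] /=; first by rewrite la av eqxx.
case/and4P=> -> bs lbs /IH ->; case: s {IH} bs lbs => [|c s] /= -> lbs.
  by rewrite ba.
by rewrite lbs.
Qed.

Lemma wact_rcons (N : lmodType C) s a (n : N) :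
  wact (rcons s a) n = wact s (aact a n).
Proof. by elim: s => //= b s ->. Qed.

Lemma pval_wact_gen1 s a m : live a -> normal s (src a) ->
  exists2 u : J1, val u = a & pval (wact s (gen1 a m)) = word s1 t1 s u m.
Proof.
move=> la sN; exists (Sub a la : J1) => //.
by rewrite -[a]/(val (Sub a la : J1)) gen1E pval_word.
Qed.

Lemma mcoeff_word (J : choiceType) (sJ tJ : J -> vertex Q) s j m :
  normal s (sJ j) -> (word sJ tJ s j m)@_(s, j) = vact (tJ j) m.
Proof. by move=> sN; rewrite wordE sN mcoeffUU. Qed.

Lemma mcoeff_word_ne (J : choiceType) (sJ tJ : J -> vertex Q) s j m t i :
  (s = t -> j <> i) -> (word sJ tJ s j m)@_(t, i) = 0.
Proof.
move=> ne; rewrite wordE; case: ifP => _; last exact: mcoeff0.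
by rewrite mcoeffU; case: eqP => // -[/ne].
Qed.

Let b1 (u : J2) : J1 := let: And3 _ lb _ := leadP (valP u) in
  exist (fun a => live a) (val u).2 lb.
Let b1E u : val (b1 u) = (val u).2. Proof. by rewrite /b1; case: leadP. Qed.

Lemma pval_diff2_term s x m : live x.1 -> live x.2 -> tgt x.1 = src x.2 ->
  normal s (src x.1) -> (forall c, ~~ lead c x.1) ->
  exists u1 u2 : J1, [/\ val u1 = x.1, val u2 = x.2
    & pval (wact s (diff2_term x m)) =
      word s1 t1 (rcons s x.1) u2 m + word s1 t1 s u1 (aact x.2 m)].
Proof.
move=> l1 l2 e sN nl; have sN' := normal_rcons sN l1 e nl.
have [u1 v1 w1] := pval_wact_gen1 (aact x.2 m) l1 sN.
have [u2 v2 w2] := pval_wact_gen1 m l2 sN'.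
exists u1, u2; split=> //.
by rewrite /diff2_term wactD pvalD -wact_rcons w1 w2.
Qed.

Lemma pval0 (J : choiceType) (sJ tJ : J -> vertex Q) :
  pval (0 : pmod M sJ tJ) = 0.
Proof. by []. Qed.

Lemma pval_sum (J : choiceType) (sJ tJ : J -> vertex Q) (I : Type) (r : seq I)
    (F : I -> pmod M sJ tJ) : pval (\sum_(i <- r) F i) = \sum_(i <- r) pval (F i).
Proof. exact: (morphDsum _ _ _ (@pvalD _ _ _ _)). Qed.

(* Only the first of the terms of [diff2] ends in a leading word. *)
Lemma mcoeff_diff2 (z : P2) s u :
  (pval (diff2 z))@_(rcons s (val u).1, b1 u) = (pval z)@_(s, u).
Proof.
move: z; apply: pmod_ind => [|x y IHx IHy|q w m qN].
- by rewrite linear0 !pval0 !mcoeff0.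
- by rewrite linearD !pvalD !mcoeffD IHx IHy.
have [la lb e] := leadP (valP w).
have na c : ~~ lead c (val w).1.
  by apply/negP => ca; have := lead_lead (val w).2 ca; rewrite (valP w).
rewrite linear_wact diff2_genE /diff2_gen wactD pvalD mcoeffD pval_word //.
rewrite (morphDsum _ _ _ (@wactD _ q)) pval_sum raddf_sum /=.
rewrite big_seq big1 ?addr0 => [|x xw]; last first.
  have [/andP[k1 k2] es ex et nx] := tailP (valP w) xw.
  have qNx : normal q (src x.1) by rewrite es.
  have nlx c := lead_tail c (valP w) xw.
  have [u1 [u2 [v1 v2 ->]]] := pval_diff2_term m k1 k2 ex qNx nlx.
  (* If one of the two indices matched, then either [x.1] would be the last letter of the leading
     word [u], or the tail word [x] would itself be leading. *)
  rewrite mcoeffD !mcoeff_word_ne ?addr0 // => [_ u1E|/rcons_inj[_ ex1] u2E].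
    by have := nlx (val u).1; rewrite -v1 u1E b1E (valP u).
  by case/negP: nx; rewrite ex1 -v2 u2E b1E (valP u).
have [u1 [u2 [v1 v2 ->]]] := pval_diff2_term m la lb e qN na.
rewrite mcoeffD [X in _ + X]mcoeff_word_ne ?addr0 => [|_ u1E]; last first.
  by have := na (val u).1; rewrite -v1 u1E b1E (valP u).
have [[qs wu]|ne] := pselect (q = s /\ w = u).
  have u2E : u2 = b1 w by apply: val_inj; rewrite b1E.
  rewrite -qs -wu -u2E !mcoeff_word //; last by apply: normal_rcons; rewrite /s1 ?v2.
  by rewrite /t1 /t2 v2.
rewrite !mcoeff_word_ne // => [qs wu|/rcons_inj[qs a1] u2E]; case: ne; split=> //.
apply: val_inj; apply: (injective_projections _ _ a1).
exact: etrans (esym v2) (etrans (congr1 val u2E) (b1E u)).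
Qed.

Lemma diff2_inj z : diff2 z = 0 -> z = 0.
Proof.
move=> z0; apply: pval_inj; apply/malgP => -[s u].
by rewrite -mcoeff_diff2 z0 !pval0 !mcoeff0.
Qed.

Lemma proj_dim_le2 : proj_dim_le M 2.
Proof.
(* Over the empty index type the construction gives a zero module, which fills the degrees above
   2. *)
pose v0 : void -> vertex Q := of_void _.
have P30 (x : pmod M v0 v0) : x = 0.
  move: x; apply: pmod_ind => [//|x y -> ->|s []]; exact: addr0.
pose P i : lmodType C := match i with
  | 0%N => P0 | 1%N => P1 | 2%N => P2 | _ => pmod M v0 v0 end.
pose d i : {linear P i.+1 -> P i} := match i with
  | 0%N => diff1 | 1%N => diff2 | 2%N => \0 | _ => \0 end.
exists P, d, aug; split.
- by case=> [|[|[|i]]]; exact: pmod_projective.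
- by move=> m; exists (unit0 m); exact: aug_unit0.
- move=> x; split=> [x0|[y <-]]; last exact: aug_diff1.
  by exists (fox x); rewrite [LHS]diff1_fox x0 (morphD0 unit0D) subr0.
- case=> [|[|i]] x; split.
  + move=> x0; have [z] := fox_diff1 x; rewrite [diff1 x]x0 (morphD0 foxD) => e.
    by exists (- z); rewrite linearN; apply/eqP; rewrite eq_sym -addr_eq0 -e.
  + by case=> y <-; exact: diff1_diff2.
  + by move/diff2_inj => ->; exists 0; rewrite linear0.
  + by case=> y <-; rewrite [d 2%N y]/= linear0.
  + by move=> _; exists 0; rewrite linear0 [x]P30.
  + by move=> _; case: i x => [|i] x.
by case=> [|[|[|i]]] // _ x; exact: P30.
Qed.

End Resolution.

Theorem quadratic_presentation_gldim : global_dim_le C 2.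
Proof. by move=> M; exact: proj_dim_le2. Qed.

End QuadraticPresentation.

(** * Kernels of iterated quotients *)

Section Ideals.
Variables (R : pzRingType) (K : R -> Prop).
Implicit Types x y : R.

Lemma two_sided_idealD x y : two_sided_ideal K x -> two_sided_ideal K y ->
  two_sided_ideal K (x + y).
Proof.
move=> Kx Ky; rewrite -[y]opprK; apply: ideal_sub => //; rewrite -[- y]add0r.
by apply: ideal_sub => //; exact: ideal_zero.
Qed.

Lemma two_sided_ideal_sum (I : Type) (s : seq I) (P : pred I) (F : I -> R) :
  (forall i, P i -> two_sided_ideal K (F i)) ->
  two_sided_ideal K (\sum_(i <- s | P i) F i).
Proof.
by move=> KF; apply: big_ind => //; [exact: ideal_zero | exact: two_sided_idealD].
Qed.

Lemma two_sided_ideal_min (G : R -> Prop) x :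
  (forall y, G y -> two_sided_ideal K y) -> two_sided_ideal G x -> two_sided_ideal K x.
Proof.
move=> GK; elim=> {x} [x /GK //||x y _ Kx _ Ky|a x _ Kx|x a _ Kx].
- exact: ideal_zero.
- exact: ideal_sub.
- exact: ideal_mull.
- exact: ideal_mulr.
Qed.

(** The cut algebra is a quotient of a quotient; this compares its kernel with an ideal of the path
    algebra given by generators. Membership derived in the inner quotient is lifted step by step
    through [repr]. *)
Lemma quot_quot_ker (G : R -> Prop) (H : quot_ring G -> Prop) x :
  (forall y, G y -> two_sided_ideal K y) ->
  (forall z, H z -> exists2 y, z = quot_proj G y & two_sided_ideal K y) ->
  quot_proj H (quot_proj G x) = 0 -> two_sided_ideal K x.
Proof.
move=> GK HK; have lift y z : quot_proj G y = quot_proj G z ->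
    two_sided_ideal K z -> two_sided_ideal K y.
  move/quot_proj_eq/(two_sided_ideal_min GK) => Kyz Kz.
  by rewrite -[y](subrK z); exact: two_sided_idealD.
suff ker z : two_sided_ideal H z ->
    forall y, quot_proj G y = z -> two_sided_ideal K y.
  move=> e; apply: (ker (quot_proj G x)) => //.
  by move/quot_proj_eq: (etrans e (esym (rmorph0 (quot_proj H)))); rewrite subr0.
elim=> {z x} [z /HK[y -> Ky]||z t _ IHz _ IHt|a z _ IHz|z a _ IHz] x xz.
- exact: lift Ky.
- by apply: (lift _ 0); [rewrite xz rmorph0 | exact: ideal_zero].
- apply: (lift _ (repr z - repr t)); first by rewrite xz rmorphB /= !quot_projK.
  by apply: ideal_sub; [apply: IHz | apply: IHt]; rewrite quot_projK.
- apply: (lift _ (repr a * repr z)); first by rewrite xz rmorphM /= !quot_projK.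
  by apply: ideal_mull; apply: IHz; rewrite quot_projK.
- apply: (lift _ (repr z * repr a)); first by rewrite xz rmorphM /= !quot_projK.
  by apply: ideal_mulr; apply: IHz; rewrite quot_projK.
Qed.

End Ideals.

(** * The algebra of a cut *)

Lemma froot_triangle (T : triangulated_surface) (d : dart T) : froot cw d \in triangle d.
Proof.
have : fconnect cw d (froot cw d) by exact: connect_root.
case/connectP=> p; move: (froot cw d) => e; elim: p d => [|u p IH] d /=.
  by move=> _ ->; exact: triangle_id.
by case/andP=> /eqP <- /IH{}IH /IH; rewrite triangle_cw.
Qed.

Lemma froot_cw (T : triangulated_surface) (d : dart T) : froot cw (cw d) = froot cw d.
Proof.
apply/esym/eqP; rewrite (root_connect (fconnect_sym (@cw_inj T))).
exact: fconnect1.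
Qed.

(** Among the three rotations of a 3-cycle, exactly one is counted by the potential. *)
Lemma froot_unique (T : triangulated_surface) (d : dart T) :
  ((froot cw d == d) + (froot cw (cw d) == cw d)
    + (froot cw (cw (cw d)) == cw (cw d)) = 1)%N.
Proof.
have n1 : d != cw d by rewrite eq_sym cw_neq.
have n2 : d != cw (cw d) by rewrite eq_sym cwcw_neq.
have n3 : cw d != cw (cw d) by rewrite (inj_eq (@cw_inj T)).
rewrite !froot_cw; have := froot_triangle d; rewrite in_triangle => /or3P[]/eqP->.
- by rewrite eqxx (negbTE n1) (negbTE n2).
- by rewrite eqxx eq_sym (negbTE n1) (negbTE n3).
- by rewrite eqxx eq_sym (negbTE n2) eq_sym (negbTE n3).
Qed.

Lemma derivative_3cycle (k : fieldType) (Q : quiver) (c x y z : arrow Q) :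
  tgt x = src y -> tgt y = src z -> tgt z = src x ->
  cyclic_derivative c (pathE k (src x) [:: x; y; z]) =
  (if x == c then pathE k (src y) [:: y; z] else 0)
    + (if y == c then pathE k (src z) [:: z; x] else 0)
    + (if z == c then pathE k (src x) [:: x; y] else 0).
Proof.
move=> xy yz zx.
have ok : composable (src x) [:: x; y; z] by rewrite /= xy yz !eqxx.
have [p -> [sp ap]] := pathEP k ok.
rewrite /cyclic_derivative linextU /target sp ap /= zx eqxx.
rewrite big_mkcond big_ord_recl big_ord_recl big_ord_recl big_ord0 /= addr0 -addrA.
have -> : (if x == c then pathE k (tgt c) [:: y; z] else 0)
  = (if x == c then pathE k (src y) [:: y; z] else 0) by case: eqP => // <-; rewrite xy.
have -> : (if y == c then pathE k (tgt c) [:: z; x] else 0)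
  = (if y == c then pathE k (src z) [:: z; x] else 0) by case: eqP => // <-; rewrite yz.
have -> : (if z == c then pathE k (tgt c) [:: x; y] else 0)
  = (if z == c then pathE k (src x) [:: x; y] else 0) by case: eqP => // <-; rewrite zx.
by [].
Qed.

#[local] Arguments src {q} : simpl never.
#[local] Arguments tgt {q} : simpl never.

Section CutAlgebra.
Variables (k : fieldType) (T : triangulated_surface).
Local Notation Q := (triangulation_quiver T).
Local Notation A := (path_algebra k Q).
Local Notation ang a := (angle (a : qarrow T)).
Implicit Types (a b c : arrow Q).

Definition cyc c a b : bool := [&& ang a == cw (ang c), ang b == cw (ang a),
  tgt c == src a, tgt a == src b & tgt b == src c].

Lemma cyc_rot a b c : cyc a b c = cyc b c a.
Proof.
have rot x y z : cyc x y z -> cyc y z x.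
  case/and5P=> /eqP yx zy xy yz zx; apply/and5P; split=> //.
  by rewrite (eqP zy) yx cw3.
by apply/idP/idP => [/rot //|/rot/rot].
Qed.

Local Notation F a b := (pathE k (src a) [:: a; b]).

(* The potential takes each 3-cycle once, at the rotation selected by [froot], so
   that all its rotations have to be summed here. *)
Lemma derivative_potential c : cyclic_derivative c (potential T k) =
  \sum_a \sum_(b | cyc c a b) F a b.
Proof.
pose R a := froot cw (ang a) == ang a.
transitivity (\sum_x \sum_y \sum_(z | R x && cyc x y z)
   ((if x == c then F y z else 0) + (if y == c then F z x else 0)
    + (if z == c then F x y else 0))).
  rewrite /cyclic_derivative /potential linext_sum; apply: eq_bigr => x _.
  rewrite linext_sum; apply: eq_bigr => y _.
  rewrite linext_sum; apply: eq_bigr => z /andP[_ /and5P[_ _ /eqP ? /eqP ? /eqP ?]].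
  exact: derivative_3cycle.
(* The three sums correspond to [c] being the first, second or third letter of the rotation counted
   by the potential. *)
have split3 : \sum_a \sum_(b | cyc c a b) F a b =
    (\sum_a \sum_(b | R c && cyc c a b) F a b)
    + (\sum_a \sum_(b | R b && cyc c a b) F a b)
    + (\sum_a \sum_(b | R a && cyc c a b) F a b).
  rewrite -!big_split; apply: eq_bigr => a _ /=.
  rewrite big_mkcond [X in _ = X + _ + _]big_mkcond [X in _ = _ + X + _]big_mkcond.
  rewrite [X in _ = _ + X]big_mkcond -!big_split; apply: eq_bigr => b _ /=.
  case: (boolP (cyc c a b)) => [|_]; rewrite ?andbT ?andbF ?addr0 //.
  case/and5P=> /eqP ac /eqP ba _ _ _; have := froot_unique (ang c).
  rewrite -ac -ba -/(R c) -/(R a) -/(R b).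
  move: (pathE k _ _) => X.
  by case: (R c); case: (R a); case: (R b) => // _; rewrite ?addr0 ?add0r.
rewrite split3.
have term1 : \sum_x \sum_y \sum_(z | R x && cyc x y z) (if x == c then F y z else 0)
    = \sum_a \sum_(b | R c && cyc c a b) F a b.
  rewrite -(big_pred1_eq +%R c (fun x => \sum_y \sum_(z | R x && cyc x y z) F y z)).
  rewrite [RHS]big_mkcond; apply: eq_bigr => x _; case: eqP => // _.
  by rewrite big1 // => y _; rewrite big1.
have term2 : \sum_x \sum_y \sum_(z | R x && cyc x y z) (if y == c then F z x else 0)
    = \sum_a \sum_(b | R b && cyc c a b) F a b.
  transitivity (\sum_x \sum_(z | R x && cyc x c z) F z x).
    apply: eq_bigr => x _.
    rewrite -(big_pred1_eq +%R c (fun y => \sum_(z | R x && cyc x y z) F z x)).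
    rewrite [RHS]big_mkcond; apply: eq_bigr => y _; case: eqP => // _.
    by rewrite big1.
  under eq_bigr do rewrite big_mkcond.
  rewrite exchange_big; apply: eq_bigr => a _.
  by rewrite -big_mkcond; apply: eq_bigl => b; rewrite cyc_rot.
have term3 : \sum_x \sum_y \sum_(z | R x && cyc x y z) (if z == c then F x y else 0)
    = \sum_a \sum_(b | R a && cyc c a b) F a b.
  apply: eq_bigr => x _; rewrite [RHS]big_mkcond; apply: eq_bigr => y _.
  rewrite (cyc_rot c x y).
  rewrite -(big_pred1_eq +%R c (fun z => if R x && cyc x y z then F x y else 0)).
  rewrite [LHS]big_mkcond [RHS]big_mkcond; apply: eq_bigr => z _.
  by case: eqP; case: (_ && _).
rewrite -term1 -term2 -term3 -!big_split; apply: eq_bigr => x _.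
by rewrite -!big_split; apply: eq_bigr => y _; rewrite -!big_split.
Qed.

Variable cut : {set dart T}.
Hypothesis Hcut : admissible_cut cut.

Lemma cut_unique d e : d \in cut -> e \in cut -> e \in triangle d -> e = d.
Proof.
move=> dc ec ed; have /andP[di dn] := Hcut.1 d dc.
have /eqP/cards1P[u uE] := Hcut.2 d di dn.
have : e \in [set u] by rewrite -uE inE ec.
have : d \in [set u] by rewrite -uE inE dc triangle_id.
by rewrite !inE => /eqP-> /eqP.
Qed.

Definition live a := ang a \notin cut.
(* The middle arc of a leading pair is a plain side; its tail is the pair through
   the radius, which is present only when this side is a loop. *)
Definition lead a b := [&& ang b == cw (ang a), tgt a == src b, ~~ trad a
  & cw (ang b) \in cut].
Definition tailp a b (x : arrow Q * arrow Q) := [&& ang x.1 == ang a,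
  src x.1 == src a, ang x.2 == ang b, tgt x.2 == tgt b, tgt x.1 == src x.2
  & trad x.1].
Definition tail a b := [seq x <- enum {: arrow Q * arrow Q} | tailp a b x].

Lemma leadP a b : lead a b -> [/\ live a, live b & tgt a = src b].
Proof.
case/and4P=> /eqP ba /eqP ab _ bcut; rewrite /live; split=> //; apply/negP => ac.
  have aE : ang a = cw (cw (ang b)) by rewrite ba cw3.
  have atri : ang a \in triangle (cw (ang b)) by rewrite aE cw_triangle triangle_id.
  have /eqP := cut_unique bcut ac atri; rewrite aE; exact/negP/cw_neq.
have btri : ang b \in triangle (cw (ang b)) by rewrite triangle_cw triangle_id.
have /esym/eqP := cut_unique bcut ac btri; exact/negP/cw_neq.
Qed.

Lemma mem_tail a b x : (x \in tail a b) = tailp a b x.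
Proof. by rewrite mem_filter mem_enum andbT. Qed.

Lemma tailP a b x : lead a b -> x \in tail a b ->
  [/\ live x.1 && live x.2, src x.1 = src a, tgt x.1 = src x.2, tgt x.2 = tgt b
    & ~~ lead x.1 x.2].
Proof.
move=> ab; rewrite mem_tail.
case/andP=> /eqP a1 /andP[/eqP a2 /andP[/eqP a3 /andP[/eqP a4 /andP[/eqP a5 a6]]]].
have [la lb _] := leadP ab; split=> //; first by rewrite /live a1 a3; apply/andP.
by rewrite /lead a6 /= !andbF.
Qed.

(** A leading pair starting at the angle of [b] would have the angle of [a] as its third, cut one,
    but [a] is live. *)
Lemma lead_lead_angle a b c x : lead a b -> ang x = ang b -> ~~ lead x c.
Proof.
move=> ab xb; have [la _ _] := leadP ab; apply: contra la.
case/and4P: ab => /eqP ba _ _ _ /and4P[/eqP cx _ _].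
by rewrite cx xb ba cw3.
Qed.

Lemma lead_lead a b c : lead a b -> ~~ lead b c.
Proof. by move/lead_lead_angle; apply. Qed.

Lemma tail_lead a b c x : lead a b -> x \in tail a b -> ~~ lead x.2 c.
Proof.
move=> ab; rewrite mem_tail => /andP[_ /andP[_ /andP[/eqP xb _]]].
exact: lead_lead_angle ab xb.
Qed.

Lemma lead_tail a b c x : lead a b -> x \in tail a b -> ~~ lead c x.1.
Proof.
move=> ab; rewrite mem_tail => /andP[/eqP xa _].
have [_ lb _] := leadP ab; apply: contra lb => /and4P[_ _ _].
by case/and4P: ab => /eqP-> _ _ _; rewrite xa.
Qed.

Local Notation W := (potential T k).
Local Notation relations := (quadratic_relations (k := k) live lead tail).

(** A term of the derivative passes the same two angles as [a b], between the same ends; only its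
    middle vertex can differ, being the plain side or its radius. *)
Lemma derivative_lead c a b : lead a b -> cyc c a b ->
  cyclic_derivative c W = quadratic_relation k tail a b.
Proof.
move=> ab cab; have /and5P[/eqP ac /eqP ba /eqP ca /eqP tab /eqP bc] := cab.
have ntr : trad a = false by case/and4P: ab => _ _ /negbTE.
have nsr : srad b = false by have [<-] := tgt_src tab.
rewrite derivative_potential.
transitivity (\sum_(x | cyc c x.1 x.2) arrE k x.1 * arrE k x.2).
  rewrite pair_big_dep /=; apply: eq_bigr => x /and5P[_ _ _ /eqP x12 _].
  by rewrite -arrow_arrow.
have cycE x : cyc c x.1 x.2 = (x == (a, b)) || tailp a b x.
  case: x => x y /=; apply/idP/orP.
    case/and5P=> /eqP xc /eqP yx /eqP cx /eqP xy /eqP yc.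
    have xa : ang x = ang a by rewrite xc ac.
    have yb : ang y = ang b by rewrite yx ba xa.
    have sxa : src x = src a by rewrite -cx ca.
    have tyb : tgt y = tgt b by rewrite yc bc.
    rewrite /tailp /= xa yb sxa tyb xy !eqxx /=.
    case: (boolP (trad x)) => tx; [by right | left].
    have [sx _] := src_src sxa; have [ty _] := tgt_tgt tyb.
    have [sy _] := tgt_src xy.
    have -> : x = a by apply: arrow_ext; rewrite ?ntr // (negbTE tx).
    have -> : y = b by apply: arrow_ext; rewrite // -sy nsr (negbTE tx).
    exact: eqxx.
  case=> [/eqP[-> ->] //|].
  case/andP=> /eqP /= a1 /andP[/eqP a2 /andP[/eqP a3 /andP[/eqP a4 /andP[/eqP a5 _]]]].
  rewrite /cyc a1 a3 a2 a4 a5 eqxx.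
  by case/and5P: cab => -> -> -> _ ->.
rewrite (eq_bigl _ _ cycE) (bigD1 (a, b)) ?eqxx //=; congr (_ + _).
rewrite /tail big_filter big_enum_cond /=; apply: eq_bigl => x.
case: (eqVneq x (a, b)) => [->|] /=; last by rewrite andbT.
by rewrite /tailp /= ntr !andbF.
Qed.

Lemma cyc_internal c a b : cyc c a b -> internal (ang c).
Proof.
case/and5P=> /eqP ac /eqP ba _ _ _.
have [i0 i1] := andP (angle_interior c); have [_ i2] := andP (angle_interior a).
by rewrite /internal i0 i1 -ac i2.
Qed.

(** If [c] is cut and lies on a 3-cycle, moving the middle vertex of the remaining path to the plain
    side gives a leading pair with this derivative. If [c] is not cut, the cut angle of its triangle
    is that of one of the two arrows in each term. *)
Lemma derivative_relations c : two_sided_ideal relations (cyclic_derivative c W).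
Proof.
have [ccut|cn] := boolP (ang c \in cut).
  have [[a1 [b1 cab]]|no] := pselect (exists a b, cyc c a b); last first.
    rewrite derivative_potential big1 => [|a _]; first exact: ideal_zero.
    by rewrite big_pred0 // => b; apply/negP => cab; case: no; exists a, b.
  case/and5P: (cab) => /eqP ac /eqP ba /eqP ca /eqP ab /eqP bc.
  have [na sa ta] := arrowP a1; have [nb sb tb] := arrowP b1.
  have tf : side_ok (cw (ang a1)) false by case/andP: ta => ta _; rewrite /side_ok ta.
  have sf : side_ok (ang b1) false by case/andP: sb => sb _; rewrite /side_ok sb.
  have [a [a2 a3 a4]] := arrow_exists na sa tf.
  have [b [b2 b3 b4]] := arrow_exists nb sf tb.
  have abE : tgt a = src b by apply: tgt_srcI; rewrite ?a2 ?b2 ?a4 ?b3.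
  have sE : src a = src a1 by exact: src_srcI.
  have tE : tgt b = tgt b1 by exact: tgt_tgtI.
  have cab' : cyc c a b.
    by move: cab; rewrite /cyc a2 b2 sE tE abE eqxx => /and5P[-> -> -> _ ->].
  have lab : lead a b by rewrite /lead a2 b2 a4 abE ba ac cw3 !eqxx.
  by rewrite (derivative_lead lab cab'); apply: ideal_gen; left; exists a, b.
rewrite derivative_potential; apply: two_sided_ideal_sum => a _.
apply: two_sided_ideal_sum => b cab; have ic := cyc_internal cab.
case/and5P: cab => /eqP ac /eqP ba _ /eqP ab _; rewrite -arrow_arrow //.
have [ae|an] := boolP (ang a \in cut).
  by apply: ideal_mulr; apply: ideal_gen; right; exists a; rewrite /live ?negbK.
have [be|bn] := boolP (ang b \in cut).
  by apply: ideal_mull; apply: ideal_gen; right; exists b; rewrite /live ?negbK.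
have /eqP/cards1P[u uE] := Hcut.2 _ ic (angle_nsf c).
have : u \in cut :&: triangle (ang c) by rewrite uE inE.
rewrite in_setI in_triangle => /andP[uc /or3P[]/eqP ue].
- by rewrite -ue uc in cn.
- by rewrite ac -ue uc in an.
- by rewrite ba ac -ue uc in bn.
Qed.

Local Notation C := (cut_algebra W (cut_arrows cut)).
Let proj1 : {rmorphism A -> jacobian_algebra W} := quot_proj _.
Let proj2 : {rmorphism jacobian_algebra W -> C} := quot_proj _.
Let proj : {rmorphism A -> C} := proj2 \o proj1.

Lemma cut_algebra_gldim : global_dim_le C 2.
Proof.
apply: (@quadratic_presentation_gldim k Q live lead tail leadP tailP lead_lead
  tail_lead lead_tail C proj).
- move=> c; exists (repr (repr c : jacobian_algebra W)).
  rewrite /proj /=; rewrite (quot_projK (repr c : jacobian_algebra W)).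
  exact: quot_projK.
- move=> r [[a [b [ab ->]]]|[a la ->]].
    have /and4P[/eqP ba /eqP tab _ _] := ab.
    have [na sa _] := arrowP a; have [nb _ tb] := arrowP b.
    have ncw : ~~ self_folded (cw (ang b)) by rewrite self_folded_cw.
    have sa' : side_ok (cw (cw (ang b))) (srad a) by rewrite ba cw3.
    (* The arrow at the cut angle which closes [a b] to a 3-cycle; the relation led by [a b] is the
       derivative along it. *)
    have [c [c1 c2 c3]] := arrow_exists ncw tb sa'.
    have cab : cyc c a b.
      have ca : tgt c = src a by apply: tgt_srcI; rewrite ?c1 ?ba ?cw3.
      have bc : tgt b = src c by apply: tgt_srcI; rewrite ?c1.
      by rewrite /cyc c1 ca bc tab ba cw3 !eqxx.
    rewrite -(derivative_lead ab cab).
    have e : proj1 (cyclic_derivative c W) = 0.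
      rewrite -(rmorph0 proj1); apply/quot_proj_eq; rewrite subr0.
      by apply: ideal_gen; exists c.
    by rewrite -[LHS]/(proj2 (proj1 _)) e rmorph0.
  rewrite -[LHS]/(proj2 (proj1 _)) -(rmorph0 proj2).
  apply/quot_proj_eq; rewrite subr0 arrEE; apply: ideal_gen; exists a => //.
  by rewrite inE; move: la; rewrite /live negbK.
move=> r; apply: quot_quot_ker => [y [c ->]|z [a acut ->]].
  exact: derivative_relations.
exists (arrowE k a) => //; apply: ideal_gen; right; exists a; rewrite ?arrEE //.
by move: acut; rewrite inE /live => ->.
Qed.

End CutAlgebra.

Theorem mainTheorem3 (k : closedFieldType) (T : triangulated_surface)
    (cut : {set dart T})
    (HS : punctured_polygon T) (H1 : valency1 T) (Hcut : admissible_cut cut) :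
  admissible_quiver_cut (cut_arrows cut) /\
  global_dim_le (cut_algebra (potential T k) (cut_arrows cut)) 2.
Proof.
split; first exact: cut_arrows_admissible.
exact: cut_algebra_gldim.
Qed.
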